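(* Suppose that Assumptions A and B (stated in the context) hold. Let $K\ge 2$ and let $x_K$ be generated by Algorithm 1 (stated in the context) with the parameters chosen as $$\rho_k=\rho,\qquad \beta_k=\frac{k+1}{2},\qquad \gamma_k=\frac{k+1}{4(L_{\nabla f}+\rho_kL_{\nabla c^2})}\qquad\text{for all }1\le k<K,$$ where $\rho=K^{3/2}$. Then \begin{align*} &\|[c(x_K)]_+\|\le (6GD_{\mathcal X})^{1/2}K^{-3/4}+(12L_{\nabla c^2})^{1/2}D_{\mathcal X}K^{-1}+2\Lambda K^{-3/2}+(12L_{\nabla f})^{1/2}D_{\mathcal X}K^{-7/4},\\ &\mathbb E[F(x_K)-F^*]\le \big(6L_{\nabla c^2}D_{\mathcal X}^2+3\sigma^2L_{\nabla c^2}^{-1}\big)K^{-1/2}+6L_{\nabla f}D_{\mathcal X}^2K^{-2},\\ &\mathbb E[F(x_K)-F^*]\ge -\Lambda\Big((12L_{\nabla c^2}D_{\mathcal X}^2+6\sigma^2L_{\nabla c^2}^{-1})^{1/2}K^{-1}+2\Lambda K^{-3/2}+(12L_{\nabla f})^{1/2}D_{\mathcal X}K^{-7/4}\Big). \end{align*}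
   Context: Notation. $\|\cdot\|$ is the Euclidean norm, $\langle\cdot,\cdot\rangle$ the standard inner product, $[\cdot]_+$ the projection onto the nonnegative orthant. $\nabla\phi$ denotes the transpose of the Jacobian of $\phi$. A mapping $\phi$ is $L_\phi$-Lipschitz continuous on $\Omega$ if $\|\phi(x)-\phi(x')\|\le L_\phi\|x-x'\|$ for all $x,x'\in\Omega$, and $L_{\nabla\phi}$-smooth on $\Omega$ if $\|\nabla\phi(x)-\nabla\phi(x')\|\le L_{\nabla\phi}\|x-x'\|$ for all $x,x'\in\Omega$. $\mathrm{prox}_{\gamma\psi}(v)=\arg\min_x\{\gamma\psi(x)+\tfrac12\|x-v\|^2\}$. Problem. $F^*=\min_x\{F(x):=\mathbb E[\tilde f(x,\xi)]+\psi(x)\}$ subject to $c(x)\le 0$, where $\xi$ is a random variable with (infinite) sample space $\Xi$, $\tilde f(\cdot,\xi)$ is a continuously differentiable convex function on $\mathbb R^n$ for each $\xi\in\Xi$, $\psi:\mathbb R^n\to\mathbb R\cup\{+\infty\}$ is proper closed convex with domain $\mathcal X$, and $c=(c_1,\dots,c_m)$ is a deterministic smooth mapping with each $c_i$ convex. Put $f(x)=\mathbb E[\tilde f(x,\xi)]$. Assumption A. (i) $\mathcal X$ is bounded and there exist $D_{\mathcal X}>0$, $D_F>0$ with $\max_{x,y\in\mathcal X}\|x-y\|\le D_{\mathcal X}$ and $\max_{x\in\mathcal X}F(x)-\min_{x\in\mathcal X}F(x)\le D_F$. (ii) Each $c_i$ is $L_{c_i}$-Lipschitz continuous and $L_{\nabla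 c_i}$-smooth on $\mathcal X$, and $|c_i(x)|\le C_i$ for all $x\in\mathcal X$, $i=1,\dots,m$. (iii) The set $\boldsymbol{\Lambda}^*$ of optimal Lagrange multipliers of the problem (i.e. of $\lambda\ge0$ with $F^*=\min_x\{F(x)+\langle\lambda,c(x)\rangle\}$) is nonempty; $\Lambda:=\min_{\lambda\in\boldsymbol{\Lambda}^*}\|\lambda\|$. Define $L_{\nabla c^2}:=\sum_{i=1}^m(L_{c_i}^2+C_iL_{\nabla c_i})$, taken to be positive. Assumption B. $f$ is $L_{\nabla f}$-smooth on $\mathcal X$, and for constants $\sigma>0$, $G>0$ and all $x\in\mathcal X$: $\mathbb E[\nabla\tilde f(x,\xi)]=\nabla f(x)$, $\mathbb E[\|\nabla\tilde f(x,\xi)-\nabla f(x)\|^2]\le\sigma^2$, $\max_{\xi\in\Xi}\|\nabla\tilde f(x,\xi)\|\le G$. Algorithm 1. Input: $x_1\in\mathcal X$, $\{\beta_k\}\subset[1,\infty)$, $\{\gamma_k\}\subset(0,\infty)$, $\{\rho_k\}\subset(0,\infty)$. Set $z_1=x_1$. For $k=1,2,\dots$: $y_k=(1-\beta_k^{-1})x_k+\beta_k^{-1}z_k$; sample $\xi_k\in\Xi$ (a copy of $\xi$ drawn independently of the previous samples) and set $g_k=\nabla\tilde f(y_k,\xi_k)+\rho_k\nabla c(y_k)[c(y_k)]_+$; $z_{k+1}=\mathrm{prox}_{\gamma_k\psi}(z_k-\gamma_kg_k)$; $x_{k+1}=(1-\beta_k^{-1})x_k+\beta_k^{-1}z_{k+1}$.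 *)

(* Defs.v *)
(* Points of R^n are row vectors 'rV[R]_n. Their topology is the library's; the
   library's norm on matrices is the sup norm, so the Euclidean norm [enorm] is
   defined separately. *)
From HB Require Import structures.
From mathcomp Require Import all_boot all_order all_algebra.
From mathcomp Require Import all_classical all_reals all_analysis.
Import numFieldNormedType.Exports.

Set Implicit Arguments.
Unset Strict Implicit.
Unset Printing Implicit Defensive.

Import Order.TTheory GRing.Theory Num.Theory.

Local Open Scope classical_set_scope.
Local Open Scope ring_scope.

Definition dotv (R : realType) n (u v : 'rV[R]_n) : R :=
  \sum_(i < n) u 0 i * v 0 i.

Definition enorm (R : realType) n (u : 'rV[R]_n) : R := Num.sqrt (dotv u u).

Definition pos_part (R : realType) n (v : 'rV[R]_n) : 'rV[R]_n :=
  \row_i Num.max (v 0 i) 0.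

(* [pos_part] is the Euclidean projection onto the nonnegative orthant. *)
Lemma pos_part_proj (R : realType) n (v : 'rV[R]_n) :
  (forall i, 0 <= pos_part v 0 i) /\
  (forall u : 'rV[R]_n, (forall i, 0 <= u 0 i) ->
     enorm (v - pos_part v) <= enorm (v - u)).
Proof.
split=> [i|u u0]; first by rewrite mxE le_max lexx orbT.
rewrite /enorm ler_wsqrtr// /dotv ler_sum// => i _; rewrite !mxE.
rewrite -!expr2 -[leLHS]real_normK ?num_real// -[leRHS]real_normK ?num_real//.
rewrite lerXn2r ?nnegrE//; have := u0 i.
have [v0|v0] := leP (v 0 i) 0; last by rewrite subrr normr0.
by move=> ui; rewrite subr0 !ler0_norm ?subr_le0 ?(le_trans v0)// lerN2 gerBl.
Qed.

(* Gradient of a scalar function, as the vector of its partial derivatives; it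
   is only used together with differentiability at the point. *)
Definition grad (R : realType) n (phi : 'rV[R]_n -> R) (x : 'rV[R]_n) :
    'rV[R]_n :=
  \row_i 'D_(delta_mx 0 i) phi x.

Definition C1 (R : realType) n (phi : 'rV[R]_n -> R) : Prop :=
  (forall x, differentiable phi x) /\ continuous (grad phi).

Definition convex_fun (R : realType) n (phi : 'rV[R]_n -> R) : Prop :=
  convex_function (setT : set (convex_lmodType 'rV[R]_n)) phi.

Definition elipschitz_on (R : realType) n (L : R) (X : set 'rV[R]_n)
    (phi : 'rV[R]_n -> R) : Prop :=
  forall x y, X x -> X y -> `|phi x - phi y| <= L * enorm (x - y).

Definition smooth_on (R : realType) n (L : R) (X : set 'rV[R]_n)
    (phi : 'rV[R]_n -> R) : Prop :=
  (forall x, X x -> differentiable phi x) /\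
  (forall x y, X x -> X y ->
     enorm (grad phi x - grad phi y) <= L * enorm (x - y)).

Definition dom (R : realType) n (psi : 'rV[R]_n -> \bar R) : set 'rV[R]_n :=
  [set x | (psi x < +oo)%E].

Definition epi (R : realType) n (psi : 'rV[R]_n -> \bar R) :
    set ('rV[R]_n * R^o) :=
  [set p | (psi p.1 <= (p.2)%:E)%E].

(* Proper closed convex function with values in R u {+oo}. *)
Record proper_closed_convex (R : realType) n (psi : 'rV[R]_n -> \bar R) :
    Prop := ProperClosedConvex {
  pcc_noty : forall x, psi x != -oo%E ;
  pcc_dom : dom psi !=set0 ;
  pcc_closed : closed (epi psi) ;
  pcc_convex : convex_set (epi psi : set (convex_lmodType ('rV[R]_n * R^o)%type))
}.

Definition is_min d (T : porderType d) (S : set T) (v : T) : Prop :=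
  S v /\ forall u, S u -> (v <= u)%O.

(* The arg min as a set; for a proper closed convex psi and gamma > 0 it is a
   singleton. *)
Definition prox (R : realType) n (gamma : R) (psi : 'rV[R]_n -> \bar R)
    (v : 'rV[R]_n) : set 'rV[R]_n :=
  [set z | forall x, (gamma%:E * psi z + (2^-1 * enorm (z - v) ^+ 2)%:E <=
                      gamma%:E * psi x + (2^-1 * enorm (x - v) ^+ 2)%:E)%E].

Section Problem.
Context (R : realType) (n m : nat) (d d' : measure_display)
  (T : measurableType d) (P : probability T R) (Xi : measurableType d').
Implicit Types (ftilde : 'rV[R]_n -> Xi -> R) (psi : 'rV[R]_n -> \bar R)
  (c : 'rV[R]_n -> 'rV[R]_m).

(* Meaningful as a real number when [ftilde x \o xi] is integrable. *)
Definition expected_fun ftilde (xi : {RV P >-> Xi}) (x : 'rV[R]_n) : R :=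
  fine 'E_P[fun w => ftilde x (xi w)].

Definition objective ftilde (xi : {RV P >-> Xi}) psi (x : 'rV[R]_n) : \bar R :=
  ((expected_fun ftilde xi x)%:E + psi x)%E.

Definition feasible c : set 'rV[R]_n := [set x | forall i, c x 0 i <= 0].

Definition opt_multipliers (F : 'rV[R]_n -> \bar R) c (Fstar : R) :
    set 'rV[R]_m :=
  [set lam : 'rV[R]_m | (forall i, 0 <= lam 0 i) /\
     is_min (range (fun x => F x + (dotv lam (c x))%:E)%E) Fstar%:E].

Definition smoothness_c2 (Lc Lgc C : 'I_m -> R) : R :=
  \sum_(i < m) (Lc i ^+ 2 + C i * Lgc i).

(* The columns of the transposed Jacobian of c are the gradients of the c_i, so
   the sum below is the product of that matrix with [c(x)]_+. *)
Definition penalty_grad c (x : 'rV[R]_n) : 'rV[R]_n :=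
  \sum_(i < m) pos_part (c x) 0 i *: grad (fun u => c u 0 i) x.

(* One sample path of the method; [s] is the realized sequence of samples.
   Indices start at 1, the values at index 0 are irrelevant. *)
Record algorithm_run ftilde psi c (x1 : 'rV[R]_n) (beta gamma rho : nat -> R)
    (s : nat -> Xi) (x y z g : nat -> 'rV[R]_n) : Prop := AlgorithmRun {
  run_x1 : x 1%N = x1 ;
  run_z1 : z 1%N = x1 ;
  run_y : forall k, (1 <= k)%N ->
    y k = (1 - (beta k)^-1) *: x k + (beta k)^-1 *: z k ;
  run_g : forall k, (1 <= k)%N ->
    g k = grad (fun u => ftilde u (s k)) (y k) + rho k *: penalty_grad c (y k) ;
  run_z : forall k, (1 <= k)%N ->
    prox (gamma k) psi (z k - gamma k *: g k) (z k.+1) ;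
  run_x : forall k, (1 <= k)%N ->
    x k.+1 = (1 - (beta k)^-1) *: x k + (beta k)^-1 *: z k.+1
}.

(* Mutual independence of (X_k)_{k in I}: product rule over finite subfamilies. *)
Definition mutually_independent (I : set nat) (X : nat -> {RV P >-> Xi}) :
    Prop :=
  forall (s : seq nat) (A : nat -> set Xi), uniq s ->
    (forall k, k \in s -> I k) -> (forall k, k \in s -> measurable (A k)) ->
    P (\bigcap_(k in [set` s]) (X k @^-1` A k)) =
    (\prod_(k <- s) P (X k @^-1` A k))%E.

Definition same_law (X Y : {RV P >-> Xi}) : Prop :=
  forall A, measurable A -> distribution P X A = distribution P Y A.

End Problem.

(* Main.v *)
From HB Require Import structures.
Require Import Defs.
From mathcomp Require Import all_boot all_order all_algebra.
From mathcomp Require Import all_classical all_reals all_analysis.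
From mathcomp Require Import measurable_realfun ring lra.

(** The method is accelerated stochastic proximal gradient descent applied to the
    penalised objective Phi = F + rho / 2 |[c]_+|^2, whose smooth part satisfies
    the descent inequality with the constant L = Lf + rho Lc2 on the domain X of
    psi.

    One step is the usual combination of three inequalities: the descent lemma
    for the smooth part at the new point, convexity at the old point and at the
    comparison point u, and the variational inequality of the proximal point
    ([accelerated_step]). With theta_k = 2 / (k + 1) and
    gamma_k = (k + 1) / (4 L), multiplying by k (k + 1) makes the values
    telescope and leaves distances |u - z_k|^2 whose coefficients increase with
    k, so that their sum is at most a multiple of the squared diameter DX^2
    ([accelerated_telescope]). Hence, for u a solution, Phi (x_K) - F* is at most
    4 L DX^2 / K^2 plus the average of noise terms <delta_k, u - z_{k+1}>, where
    delta_k is the error of the sampled gradient ([run_bound]).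

    These terms are estimated in two ways. On every path |delta_k| <= 2 G, so the
    average is at most 2 G DX ([run_bound_surely]). In expectation, z_{k+1} is
    first replaced by z_k at the price of a multiple of |delta_k|^2 / (rho Lc2),
    paid for by the unused part of the quadratic term ([run_bound_noise]); the
    remaining product has mean zero because z_k and y_k depend on the earlier
    samples only. This last fact is Fubini's theorem on the product of T, with
    the sigma-algebra of the past, and the sample space ([sample_Rintegral_le]).
    It requires the iterates to be measurable for that sigma-algebra, which
    follows from the proximal map being nonexpansive and from
    [measurable_caratheodory].

    A multiplier lam of norm Lambda gives F (x) - F* >= - Lambda |[c (x)]_+|.
    Inserted in the bound on Phi it leaves
    rho / 2 v^2 - Lambda v <= B for v = |[c (x_K)]_+| on every path, and for
    its mean by Jensen's inequality, which bounds v by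
    2 Lambda / rho + (2 B / rho)^(1/2) ([quadratic_bound]). The three claims
    follow with rho = K^(3/2). *)

Set Implicit Arguments.
Unset Strict Implicit.
Unset Printing Implicit Defensive.

Import Order.TTheory GRing.Theory Num.Theory.
Import numFieldNormedType.Exports.

Local Open Scope classical_set_scope.
Local Open Scope ring_scope.

(** * Euclidean geometry of row vectors *)

Section Euclid.
Context (R : realType) (n : nat).
Implicit Types (u v w : 'rV[R]_n) (a : R).

Lemma dotvC u v : dotv u v = dotv v u.
Proof. by apply: eq_bigr => i _; rewrite mulrC. Qed.

Lemma dotvDl u v w : dotv (u + v) w = dotv u w + dotv v w.
Proof. by rewrite -big_split; apply: eq_bigr => i _; rewrite mxE mulrDl. Qed.

Lemma dotvZl a u v : dotv (a *: u) v = a * dotv u v.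
Proof. by rewrite mulr_sumr; apply: eq_bigr => i _; rewrite mxE mulrA. Qed.

Lemma dotvNl u v : dotv (- u) v = - dotv u v.
Proof. by rewrite -scaleN1r dotvZl mulN1r. Qed.

Lemma dotvBl u v w : dotv (u - v) w = dotv u w - dotv v w.
Proof. by rewrite dotvDl dotvNl. Qed.

Lemma dotvDr u v w : dotv w (u + v) = dotv w u + dotv w v.
Proof. by rewrite !(dotvC w) dotvDl. Qed.

Lemma dotvZr a u v : dotv v (a *: u) = a * dotv v u.
Proof. by rewrite !(dotvC v) dotvZl. Qed.

Lemma dotvNr u v : dotv v (- u) = - dotv v u.
Proof. by rewrite !(dotvC v) dotvNl. Qed.

Lemma dotvBr u v w : dotv w (u - v) = dotv w u - dotv w v.
Proof. by rewrite dotvDr dotvNr. Qed.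

Lemma row_subE u v i : (u - v) 0 i = u 0 i - v 0 i.
Proof. by rewrite !mxE. Qed.

Lemma dotv_suml I (r : seq I) (Q : pred I) (F : I -> 'rV[R]_n) v :
  dotv (\sum_(i <- r | Q i) F i) v = \sum_(i <- r | Q i) dotv (F i) v.
Proof.
elim/big_rec2: _ => [|i x y _ <-]; last by rewrite dotvDl.
by rewrite /dotv big1// => i _; rewrite mxE mul0r.
Qed.

Definition dotvE := (dotvDl, dotvDr, dotvBl, dotvBr, dotvZl, dotvZr,
  dotvNl, dotvNr).

Lemma dotvv_ge0 u : 0 <= dotv u u.
Proof. by apply: sumr_ge0 => i _; rewrite -expr2 sqr_ge0. Qed.

Lemma enorm_ge0 u : 0 <= enorm u.
Proof. exact: sqrtr_ge0. Qed.

Lemma enormE u : enorm u ^+ 2 = dotv u u.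
Proof. by rewrite sqr_sqrtr// dotvv_ge0. Qed.

Lemma dotvv_eq0 u : dotv u u = 0 -> u = 0.
Proof.
move=> /eqP; rewrite psumr_eq0 => [/allP u0|i _]; last first.
  by rewrite -expr2 sqr_ge0.
apply/rowP => i; rewrite mxE; apply/eqP.
by have := u0 i (mem_index_enum i); rewrite -expr2 sqrf_eq0.
Qed.

Lemma enorm_eq0 u : enorm u = 0 -> u = 0.
Proof. by move=> u0; apply: dotvv_eq0; rewrite -enormE u0 expr0n. Qed.

Lemma enormN u : enorm (- u) = enorm u.
Proof. by rewrite /enorm dotvNl dotvNr opprK. Qed.

Lemma cauchy_schwarz u v : dotv u v <= enorm u * enorm v.
Proof.
have [v0|v0] := eqVneq (enorm v) 0.
  by rewrite v0 (enorm_eq0 v0) -(subrr v) dotvBr subrr mulr0.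
have vp : 0 < enorm v by rewrite lt_def v0 enorm_ge0.
have [u0|u0] := eqVneq (enorm u) 0.
  by rewrite u0 (enorm_eq0 u0) -(subrr u) dotvBl subrr mul0r.
have up : 0 < enorm u by rewrite lt_def u0 enorm_ge0.
have := dotvv_ge0 (enorm v *: u - enorm u *: v).
rewrite !dotvE -!enormE (dotvC v u) => H.
have {}H : 0 <= (enorm u * enorm v) * (enorm u * enorm v - dotv u v) * 2.
  by apply: le_trans H _; rewrite le_eqVlt; apply/orP; left; apply/eqP; ring.
by rewrite pmulr_lge0// pmulr_rge0 ?mulr_gt0// subr_ge0 in H.
Qed.

Lemma young_dotv u v a : 0 < a ->
  2 * dotv u v <= a * enorm u ^+ 2 + a^-1 * enorm v ^+ 2.
Proof.
move=> a0; rewrite -(ler_pM2l a0) mulrDr mulrA mulVKf ?gt_eqF// !enormE.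
by have := dotvv_ge0 (a *: u - v); rewrite !dotvE (dotvC v u); lra.
Qed.

Lemma enormD u v : enorm (u + v) <= enorm u + enorm v.
Proof.
rewrite -(@ler_pXn2r _ 2)// ?nnegrE ?addr_ge0 ?enorm_ge0//.
rewrite enormE !dotvE sqrrD !enormE (dotvC v u).
by have := cauchy_schwarz u v; lra.
Qed.

Lemma enormB u v : enorm (u - v) <= enorm u + enorm v.
Proof. by rewrite -(enormN v) enormD. Qed.

Lemma coord_le_enorm u i : `|u 0 i| <= enorm u.
Proof.
rewrite -sqrtr_sqr ler_sqrt ?dotvv_ge0// /dotv (bigD1 i)//= expr2 lerDl.
by apply: sumr_ge0 => j _; rewrite -expr2 sqr_ge0.
Qed.

Lemma coord_le_norm u i : `|u 0 i| <= `|u|.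
Proof.
rewrite [leRHS]mx_normrE.
exact: (le_bigmax _ (fun i => `|u i.1 i.2|) (0, i)).
Qed.

Lemma leq_sqr_id (k : nat) : (k <= k ^ 2)%N.
Proof. by case: k => // k; rewrite leq_pmulr. Qed.

Lemma enorm_le_norm u : enorm u <= n%:R * `|u|.
Proof.
have h0 : 0 <= n%:R * `|u| :> R by rewrite mulr_ge0.
rewrite -(@ler_pXn2r _ 2)// ?nnegrE ?enorm_ge0// enormE.
apply: (@le_trans _ _ (\sum_(i < n) `|u| ^+ 2)).
  apply: ler_sum => i _; rewrite -expr2 -real_normK ?num_real//.
  by rewrite lerXn2r ?nnegrE ?coord_le_norm.
rewrite big_const_ord iter_addr_0 exprMn -[leLHS]mulr_natl.
by rewrite ler_wpM2r ?sqr_ge0// -natrX ler_nat leq_sqr_id.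
Qed.

End Euclid.

(** * Convex functions with Lipschitz gradient *)

Section Convex.
Context (R : realType) (n : nat).
Implicit Types (phi : 'rV[R]_n -> R) (X : set 'rV[R]_n) (u v x y : 'rV[R]_n).

Lemma derive_dotv phi x v :
  differentiable phi x -> 'D_v phi x = dotv (grad phi x) v.
Proof.
move=> dphi; rewrite deriveE// {1}(row_sum_delta v) linear_sum.
by apply: eq_bigr => i _; rewrite linearZ/= mxE deriveE// mulrC.
Qed.

Lemma convex_funP phi : convex_fun phi -> forall (t : R) x y,
  0 <= t -> t <= 1 -> phi (t *: x + (1 - t) *: y) <= t * phi x + (1 - t) * phi y.
Proof.
move=> cphi t x y t0 t1.
have t01 : (0 <= t <= 1) by rewrite t0 t1.
by have := cphi (Itv01 t0 t1) x y (in_setT _) (in_setT _).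
Qed.

(** The difference quotients towards [x] are at most the slope of the chord, by
    convexity; the gradient term is their limit. *)
Lemma convex_gradient_ineq phi x y : convex_fun phi -> differentiable phi y ->
  phi y + dotv (grad phi y) (x - y) <= phi x.
Proof.
move=> cphi dphi; rewrite addrC -lerBrDr -derive_dotv//.
have /cvg_dnbhs_at_right := diff_derivable (v := x - y) dphi.
move/cvgr_to_le; apply; near=> h.
have h0 : 0 < h by near: h; exact: nbhs_right_gt.
have h1 : h <= 1 by near: h; exact: nbhs_right_le.
rewrite /= /GRing.scale/= ler_pdivrMl//.
have -> : h *: (x - y) + y = h *: x + (1 - h) *: y.
  by rewrite scalerBr scalerBl scale1r addrAC addrA.
by have := convex_funP cphi x y (ltW h0) h1; lra.
Unshelve. all: by end_near. Qed.

Definition segment_closed X := forall (t : R) x y, X x -> X y ->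
  0 <= t -> t <= 1 -> X (t *: x + (1 - t) *: y).

(** The difference quotients of [phi] along the line are those defining the
    directional derivative at [t *: v + y]. *)
Lemma is_derive_line phi (y v : 'rV[R]_n) (t : R) :
  differentiable phi (t *: v + y) ->
  is_derive t (1 : R) (fun s => phi (s *: v + y)) (dotv (grad phi (t *: v + y)) v).
Proof.
move=> dphi; rewrite -derive_dotv//.
have /derivableP := diff_derivable (v := v) dphi.
have E : (fun h : R => h^-1 *: ((phi \o shift (t *: v + y)) (h *: v) -
    phi (t *: v + y))) =
  (fun h => h^-1 *: (((fun s : R => phi (s *: v + y)) \o shift t) (h *: 1) -
    phi (t *: v + y))).
  by apply/funext => h /=; rewrite [h%:A]mulr1 scalerDl addrA.
by move=> [d1 d2]; split; rewrite /derivable /derive ?/derivable -E.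
Qed.

(** The mean value theorem along the segment from [y] to [x], applied to [phi]
    minus its linearisation and minus the claimed quadratic: by Cauchy-Schwarz
    and the Lipschitz bound on the gradient, this difference has a nonpositive
    derivative. *)
Lemma descent_lemma phi X (L : R) x y : segment_closed X -> smooth_on L X phi ->
  X x -> X y ->
  phi x <= phi y + dotv (grad phi y) (x - y) + L / 2 * enorm (x - y) ^+ 2.
Proof.
move=> cX [dphi Lphi] Xx Xy; set v := x - y.
have Xl t : 0 <= t -> t <= 1 -> X (t *: v + y).
  move=> t0 t1; have -> : t *: v + y = t *: x + (1 - t) *: y.
    by rewrite scalerBr scalerBl scale1r addrAC addrA.
  exact: cX.
pose D t := dotv (grad phi (t *: v + y)) v - dotv (grad phi y) v -
   L * t * enorm v ^+ 2.
pose q t := phi (t *: v + y) - t * dotv (grad phi y) v -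
   L / 2 * enorm v ^+ 2 * t ^+ 2.
have dq (t : R) : 0 <= t -> t <= 1 -> is_derive t (1 : R) q (D t).
  move=> t0 t1; have := is_derive_line (dphi _ (Xl _ t0 t1)) => H.
  have H1 : is_derive t (1 : R) (fun t => t * dotv (grad phi y) v)
      (dotv (grad phi y) v).
    rewrite -[X in is_derive _ _ _ X]mulr1.
    have -> : (fun t => t * dotv (grad phi y) v) = (dotv (grad phi y) v) \*: id.
      by apply/funext => s; rewrite mulrC.
    exact: is_deriveZ.
  have H2 : is_derive t (1 : R) (fun t => L / 2 * enorm v ^+ 2 * t ^+ 2)
      (L * t * enorm v ^+ 2).
    have -> : (fun t => L / 2 * enorm v ^+ 2 * t ^+ 2) =
       (L / 2 * enorm v ^+ 2) \*: ((@id R) ^+ 2).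
      by apply/funext => s; rewrite fctE.
    apply: is_derive_eq; rewrite /GRing.scale/= mulr1 expr1; by field.
  exact: is_deriveB.
have [||c c01] := @MVT R q D 0 1 ltr01.
- by move=> t; rewrite in_itv/= => /andP[/ltW ? /ltW ?]; exact: dq.
- apply: derivable_within_continuous => t; rewrite in_itv/= => /andP[? ?].
  by have [] := dq t.
move: c01; rewrite in_itv/= => /andP[/ltW c0 /ltW c1].
rewrite /q /D scale1r subrK scale0r add0r => E.
have : dotv (grad phi (c *: v + y) - grad phi y) v <= L * c * enorm v ^+ 2.
  apply: le_trans (cauchy_schwarz _ _) _.
  have := Lphi _ _ (Xl _ c0 c1) Xy; rewrite addrK.
  have -> : enorm (c *: v) = c * enorm v.
    by rewrite /enorm dotvZl dotvZr mulrA -expr2 sqrtrM ?sqr_ge0// sqrtr_sqr ger0_norm.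
  by move/(ler_wpM2r (enorm_ge0 v)); rewrite expr2 !mulrA.
by rewrite dotvBl; move: E; lra.
Qed.

End Convex.

(** * The proximal operator *)

Section Prox.
Context (R : realType) (n : nat) (psi : 'rV[R]_n -> \bar R).
Hypothesis hpsi : proper_closed_convex psi.
Implicit Types (u v x y z : 'rV[R]_n).

Lemma dom_fine x : dom psi x -> psi x = (fine (psi x))%:E.
Proof.
move=> Xx; rewrite fineK// fin_numE (pcc_noty hpsi)/=.
by rewrite lt_eqF.
Qed.

Lemma pcc_convexP (t : R) x y : dom psi x -> dom psi y -> 0 <= t -> t <= 1 ->
  (psi (t *: x + (1 - t) *: y) <=
   (t * fine (psi x) + (1 - t) * fine (psi y))%:E)%E.
Proof.
move=> Xx Xy t0 t1; have t01 : (0 <= t <= 1) by rewrite t0 t1.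
pose px : convex_lmodType ('rV[R]_n * R^o)%type := (x, fine (psi x)).
pose py : convex_lmodType ('rV[R]_n * R^o)%type := (y, fine (psi y)).
have ex : px \in epi psi by rewrite inE /epi/= -dom_fine.
have ey : py \in epi psi by rewrite inE /epi/= -dom_fine.
by have := pcc_convex hpsi (Itv01 t0 t1) ex ey; rewrite inE.
Qed.

Lemma dom_segment : segment_closed (dom psi).
Proof.
move=> t x y Xx Xy t0 t1; apply: le_lt_trans (pcc_convexP Xx Xy t0 t1) _.
exact: ltry.
Qed.

Lemma fine_pcc_convex (t : R) x y : dom psi x -> dom psi y ->
  0 <= t -> t <= 1 -> fine (psi (t *: x + (1 - t) *: y)) <=
   t * fine (psi x) + (1 - t) * fine (psi y).
Proof.
move=> Xx Xy t0 t1; rewrite -lee_fin -dom_fine; first exact: pcc_convexP.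
exact: dom_segment.
Qed.

Variable (gamma : R).
Hypothesis gamma0 : 0 < gamma.

Lemma prox_dom v z : prox gamma psi v z -> dom psi z.
Proof.
move=> pz; have [x Xx] := pcc_dom hpsi.
have := pz x; rewrite [psi x]dom_fine// -EFinM -EFinD => H.
have : (gamma%:E * psi z + (2^-1 * enorm (z - v) ^+ 2)%:E < +oo)%E.
  exact: le_lt_trans H (ltry _).
rewrite /dom /=; case: (psi z) => [r _|/=|//]; first exact: ltry.
by rewrite gt0_muley ?lte_fin// ltxx.
Qed.

Lemma le0_of_small (a b : R) : 0 <= b ->
  (forall t, 0 < t -> t <= 1 -> a <= t * b) -> a <= 0.
Proof.
move=> b0 H; rewrite leNgt; apply/negP => a0.
have ab : 0 < 2 * b + a by rewrite ltr_wpDl// mulr_ge0.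
have := H (a / (2 * b + a)) (divr_gt0 a0 ab).
rewrite ler_pdivrMr// mul1r lerDr mulr_ge0// => /(_ isT).
rewrite mulrAC ler_pdivlMr// ler_pM2l// => ?; lra.
Qed.

(** First-order optimality of the minimiser, obtained by comparing [z] with
    the points of the segment from [z] to [u] close to [z]. *)
Lemma prox_variational v z u : prox gamma psi v z -> dom psi u ->
  gamma * (fine (psi z) - fine (psi u)) <= dotv (z - v) (u - z).
Proof.
move=> pz Xu; have Xz := prox_dom pz; rewrite -subr_le0.
(* [t] is the position on the segment, from [z] at 0 to [u] at 1 *)
apply: (@le0_of_small _ (dotv (u - z) (u - z) / 2)).
  by rewrite divr_ge0// dotvv_ge0.
move=> t t0 t1; rewrite -(ler_pM2l t0).
have Xm := dom_segment Xu Xz (ltW t0) t1.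
have := pz (t *: u + (1 - t) *: z).
rewrite [psi z]dom_fine// [psi (_ + _)]dom_fine// -!EFinM -!EFinD lee_fin.
have := fine_pcc_convex Xu Xz (ltW t0) t1.
set q := fine (psi (_ + _)).
move=> /(ler_wpM2l (ltW gamma0)) H1 H2.
have {H1 H2} := le_trans H2 (lerD H1 (lexx _)).
have -> : t *: u + (1 - t) *: z - v = (z - v) + t *: (u - z).
  by apply/rowP => i; rewrite !mxE; ring.
rewrite !enormE !dotvE (dotvC u z) (dotvC v z) (dotvC u v); lra.
Qed.

(** The sum of the variational inequalities of [z] tested at [z'] and of [z']
    tested at [z]. It is what makes the iterates measurable. *)
Lemma prox_nonexpansive v v' z z' :
  prox gamma psi v z -> prox gamma psi v' z' -> enorm (z - z') <= enorm (v - v').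
Proof.
move=> pz pz'.
have := prox_variational pz (prox_dom pz').
have := prox_variational pz' (prox_dom pz) => H1 H2.
have H : enorm (z - z') * enorm (z - z') <= enorm (v - v') * enorm (z - z').
  apply: le_trans (cauchy_schwarz _ _); rewrite -expr2 enormE.
  by move: H1 H2; rewrite !dotvE (dotvC z' z); lra.
have [->|e0] := eqVneq (enorm (z - z')) 0; first exact: enorm_ge0.
by rewrite ler_pM2r// lt_def e0 enorm_ge0 in H.
Qed.

End Prox.

(** * The quadratic penalty *)

Section Penalty.
Context (R : realType) (n m : nat) (c : 'rV[R]_n -> 'rV[R]_m).
Implicit Types (x y : 'rV[R]_n).

Definition penalty x : R := 2^-1 * enorm (pos_part (c x)) ^+ 2.

Lemma penaltyE x : penalty x = \sum_(i < m) Num.max (c x 0 i) 0 ^+ 2 / 2.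
Proof.
rewrite /penalty enormE /dotv mulr_sumr; apply: eq_bigr => i _.
by rewrite !mxE mulrC -expr2.
Qed.

Lemma dotv_penalty_grad x v : dotv (penalty_grad c x) v =
  \sum_(i < m) Num.max (c x 0 i) 0 * dotv (grad (fun u => c u 0 i) x) v.
Proof.
by rewrite dotv_suml; apply: eq_bigr => i _; rewrite dotvZl mxE.
Qed.

(** This lemma and the next one say that the function a |-> [a]_+^2 / 2, of
    derivative [b]_+ at b, is convex and 1-smooth. *)
Lemma half_sqr_pos_convex (a b : R) :
  Num.max b 0 ^+ 2 / 2 + Num.max b 0 * (a - b) <= Num.max a 0 ^+ 2 / 2.
Proof.
have := sqr_ge0 (a - b); have := sqr_ge0 a; have := sqr_ge0 b.
by case: (leP a 0) => Ha; case: (leP b 0) => Hb; nra.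
Qed.

Lemma half_sqr_pos_smooth (a b : R) : Num.max a 0 ^+ 2 / 2 <=
  Num.max b 0 ^+ 2 / 2 + Num.max b 0 * (a - b) + (a - b) ^+ 2 / 2.
Proof.
have := sqr_ge0 (a - b); have := sqr_ge0 a; have := sqr_ge0 b.
by case: (leP a 0) => Ha; case: (leP b 0) => Hb; nra.
Qed.

(** The outer function is convex with the nonnegative derivative [c_i]_+, so the
    convexity inequality of each [c_i] can be inserted in its own. *)
Lemma penalty_gradient_ineq x y :
  (forall i, convex_fun (fun u => c u 0 i)) ->
  (forall i, differentiable (fun u => c u 0 i) y) ->
  penalty y + dotv (penalty_grad c y) (x - y) <= penalty x.
Proof.
move=> cc dc; rewrite !penaltyE dotv_penalty_grad -big_split.
apply: ler_sum => i _ /=; apply: le_trans (half_sqr_pos_convex _ (c y 0 i)).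
rewrite lerD2l ler_wpM2l ?le_max ?lexx ?orbT// lerBrDl.
exact: convex_gradient_ineq.
Qed.

(** The outer function contributes |c_i x - c_i y|^2 / 2, bounded through the
    Lipschitz constant of [c_i]; its derivative, at most [C i], multiplies the
    curvature term of [c_i]. If [Lgc i] is negative then x = y, and the product
    [Lgc i * enorm (x - y)] is nonnegative in all cases. *)
Lemma penalty_descent X (Lc Lgc C : 'I_m -> R) x y : segment_closed X ->
  (forall i, elipschitz_on (Lc i) X (fun x => c x 0 i)) ->
  (forall i, smooth_on (Lgc i) X (fun x => c x 0 i)) ->
  (forall i x, X x -> `|c x 0 i| <= C i) -> X x -> X y ->
  penalty x <= penalty y + dotv (penalty_grad c y) (x - y)
    + smoothness_c2 Lc Lgc C / 2 * enorm (x - y) ^+ 2.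
Proof.
move=> cX lc sc bc Xx Xy.
rewrite !penaltyE dotv_penalty_grad -big_split /= /smoothness_c2 !mulr_suml.
rewrite -big_split /=; apply: ler_sum => i _.
apply: le_trans (half_sqr_pos_smooth _ (c y 0 i)) _.
set b := c y 0 i; set a := c x 0 i; set e := enorm (x - y).
set g := dotv _ _; rewrite -!addrA lerD2l.
have e0 : 0 <= e by exact: enorm_ge0.
have b0 : 0 <= Num.max b 0 by rewrite le_max lexx orbT.
have C0 : 0 <= C i by apply: le_trans (bc i y Xy).
have bC : Num.max b 0 <= C i.
  by rewrite ge_max C0 andbT (le_trans _ (bc i y Xy))// ler_norm.
have abL : (a - b) ^+ 2 <= Lc i ^+ 2 * e ^+ 2.
  rewrite -exprMn -real_normK ?num_real//.
  rewrite lerXn2r ?nnegrE ?(lc i)// (le_trans _ (lc i x y Xx Xy))//.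
have D : a - b - g <= Lgc i / 2 * e ^+ 2.
  by have := descent_lemma cX (sc i) Xx Xy; rewrite -/a -/b -/g -/e; lra.
have Lge : 0 <= Lgc i * e.
  by rewrite (le_trans _ ((sc i).2 x y Xx Xy))// enorm_ge0.
have : Num.max b 0 * (a - b - g) <= C i * (Lgc i / 2 * e ^+ 2).
  apply: le_trans (ler_wpM2l b0 D) _; apply: ler_wpM2r => //.
  by rewrite mulrAC expr2 mulrA divr_ge0// mulr_ge0.
lra.
Qed.

End Penalty.

(** * One accelerated step and its telescoping *)

Section Step.
Context (R : realType) (n : nat).
Implicit Types (h psi : 'rV[R]_n -> R).

(** Since x' - y = th (z' - z), the descent inequality at [x'] involves the
    quadratic [L th^2 / 2 |z' - z|^2]; its linear part is split between the
    convexity inequalities at [x] and at [u], with weights 1 - th and th, and the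
    proximal inequality scaled by th / gamma. The conclusion compares the
    objective at [x'] with its value at any point [u], up to the error [dl] of
    the gradient used. *)
Lemma accelerated_step h psi (L th gamma : R) (x y z x' z' u p dl : 'rV[R]_n) :
  0 <= th -> th <= 1 -> 0 < gamma ->
  y = (1 - th) *: x + th *: z -> x' = (1 - th) *: x + th *: z' ->
  h y + dotv p (x - y) <= h x -> h y + dotv p (u - y) <= h u ->
  h x' <= h y + dotv p (x' - y) + L / 2 * enorm (x' - y) ^+ 2 ->
  psi x' <= (1 - th) * psi x + th * psi z' ->
  gamma * (psi z' - psi u) <= dotv (z' - (z - gamma *: (p + dl))) (u - z') ->
  h x' + psi x' - (h u + psi u) <=
    (1 - th) * (h x + psi x - (h u + psi u))
    + th / (2 * gamma) * (enorm (u - z) ^+ 2 - enorm (u - z') ^+ 2)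
    - (th / (2 * gamma) - L * th ^+ 2 / 2) * enorm (z' - z) ^+ 2
    + th * dotv dl (u - z').
Proof.
move=> th0 th1 g0 yE x'E Hx Hu Hd Hpsi Hprox.
have x'y : x' - y = th *: (z' - z) by rewrite x'E yE opprD addrACA subrr add0r scalerBr.
move: Hd; rewrite enormE x'y dotvZl dotvZr dotvZr -enormE => Hd.
have th1' : 0 <= 1 - th by rewrite subr_ge0.
have {}Hx := ler_wpM2l th1' Hx.
have {}Hu := ler_wpM2l th0 Hu.
have thg : 0 <= th / gamma by rewrite divr_ge0// ltW.
have {}Hprox : th * (psi z' - psi u) <=
    th / (2 * gamma) * (enorm (u - z) ^+ 2 - enorm (u - z') ^+ 2 -
      enorm (z' - z) ^+ 2) + th * dotv (p + dl) (u - z').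
  have := ler_wpM2l thg Hprox.
  have -> : th / gamma * (gamma * (psi z' - psi u)) = th * (psi z' - psi u).
    by field; rewrite gt_eqF.
  move=> H; apply: le_trans H _; rewrite le_eqVlt; apply/orP; left; apply/eqP.
  rewrite !enormE !dotvE (dotvC u z') (dotvC u z) (dotvC z z').
  by field; rewrite gt_eqF.
have E : dotv p (u - z') * th = th * dotv p (u - y) - th * dotv p (z' - z)
    + (1 - th) * dotv p (x - y).
  by rewrite yE !dotvE; ring.
move: Hprox; rewrite dotvDl; move: Hx Hu Hd Hpsi E.
set q := th / _; set e := enorm (z' - z) ^+ 2.
lra.
Qed.

(** The weights k (k + 1) turn the contraction factor 1 - 2 / (k + 1) into
    exact telescoping. The coefficients k / (k + 1) of the distances increase, so
    that after summation by parts every distance can be replaced by its bound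
    [D2]; the induction keeps the last one, with a negative sign. *)
Lemma accelerated_telescope (L D2 : R) (a d N : nat -> R) (K : nat) :
  0 <= L -> (forall k, (1 <= k)%N -> d k <= D2) ->
  (forall k, (1 <= k < K)%N -> k%:R * k.+1%:R * a k.+1 <=
     k%:R * (k%:R - 1) * a k + 4 * L * (k%:R / k.+1%:R) * (d k - d k.+1) + N k) ->
  forall k, (1 <= k <= K)%N -> k%:R * (k%:R - 1) * a k <=
    4 * L * ((k%:R - 1) / k%:R) * (D2 - d k) + \sum_(1 <= j < k) N j.
Proof.
move=> L0 dD step; case=> // k /=; elim: k => [_|k IH kK].
  by rewrite big_geq// subrr !(mulr0, mul0r) addr0.
have {}IH := IH (ltnW kK).
rewrite big_nat_recr//=; have := step k.+1 kK.
set A := a k.+2; set B := a k.+1 in IH *; set S := \sum_(_ <= _ < _) _ in IH *.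
have dk := dD k.+1 isT; have dk1 := dD k.+2 isT.
have k0 : 0 <= k%:R :> R by [].
rewrite -(natr1 k.+1) -(natr1 k) in IH *; set t := k%:R in k0 IH *.
move=> H.
have C : (t + 1 - 1) / (t + 1) * (D2 - d k.+1) <=
    (t + 1) / (t + 1 + 1) * (D2 - d k.+1).
  apply: ler_wpM2r; first by rewrite subr_ge0.
  rewrite ler_pdivrMr ?ltr_wpDl// mulrAC ler_pdivlMr; last by lra.
  nra.
have := ler_wpM2l (mulr_ge0 (ler0n R 4) L0) C; move: H IH.
rewrite !addrK; set q := (t + 1) / _; set r := t / _; lra.
Qed.

End Step.

(** * Measurability by discretisation *)

Section Discretize.
Context (R : realType) (n : nat).
Implicit Types u v : 'rV[R]_n.

Definition grid_cell (k : nat) v : 'rV[int]_n :=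
  \row_j Num.floor (k.+1%:R * v 0 j).

Lemma grid_cell_close k u v : grid_cell k u = grid_cell k v ->
  `|u - v| <= k.+1%:R^-1.
Proof.
move=> /rowP E; rewrite [leLHS]mx_normrE; apply: bigmax_le => // -[i j] _ /=.
rewrite !mxE ord1; have := E j; rewrite !mxE.
have := floor_itv (k.+1%:R * u 0 j); have := floor_itv (k.+1%:R * v 0 j).
move=> /andP[a b] /andP[c d] F; rewrite F in c d.
rewrite -(ler_pM2l (ltr0Sn R k)) mulfV// -{1}(ger0_norm (ler0n R k.+1)) -normrM.
rewrite ler_norml; move: a b c d; rewrite intrD => *; lra.
Qed.

Lemma measurable_grid_cell d (H : measurableType d) (v : H -> 'rV[R]_n) k q :
  (forall j, measurable_fun setT (fun w => v w 0 j)) ->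
  measurable [set w | grid_cell k (v w) = q].
Proof.
move=> mv.
have -> : [set w | grid_cell k (v w) = q] = \bigcap_(j in [set: 'I_n])
    (fun w => k.+1%:R * v w 0 j) @^-1` `[(q 0 j)%:~R, (q 0 j + 1)%:~R[.
  apply/seteqP; split => w /=.
    by move=> <- j _ /=; rewrite mxE in_itv/= floor_itv.
  move=> wq; apply/rowP => j; rewrite mxE; apply: floor_def.
  by have := wq j Logic.I; rewrite /= in_itv/=.
apply: fin_bigcap_measurable => // j _; rewrite -[X in measurable X]setTI.
by apply: measurable_funM.
Qed.

(** A function of [w] that depends on [w] continuously through [v w] and
    measurably through [s w] is a limit of functions which freeze the first
    dependence on each cell of a finer and finer grid. It covers composites of
    Caratheodory functions, and also functions which are only known to be
    continuous along the values of [v]. *)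
Lemma measurable_caratheodory d (H : measurableType d) d1 (S : measurableType d1)
    (v : H -> 'rV[R]_n) (s : H -> S) (Phi : H -> S -> R) :
  (forall j, measurable_fun setT (fun w => v w 0 j)) -> measurable_fun setT s ->
  (forall w, measurable_fun setT (Phi w)) ->
  (forall w t (e : R), 0 < e -> exists2 r : R, 0 < r &
     forall w', `|v w' - v w| < r -> `|Phi w' t - Phi w t| < e) ->
  measurable_fun setT (fun w => Phi w (s w)).
Proof.
move=> mv ms mPhi cPhi.
pose rep k q := xget point [set w | grid_cell k (v w) = q].
have repE k w : grid_cell k (v (rep k (grid_cell k (v w)))) = grid_cell k (v w).
  apply: (@xgetPex _ point [set w' | grid_cell k (v w') = grid_cell k (v w)]).
  by exists w.
apply: (@measurable_fun_cvg _ _ _ _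
    (fun k w => Phi (rep k (grid_cell k (v w))) (s w))).
- move=> k _ Y mY; rewrite setTI.
  have -> : (fun w => Phi (rep k (grid_cell k (v w))) (s w)) @^-1` Y =
      \bigcup_(q in [set: 'rV[int]_n])
       ([set w | grid_cell k (v w) = q] `&` s @^-1` (Phi (rep k q) @^-1` Y)).
    apply/seteqP; split => w /=; first by exists (grid_cell k (v w)).
    by move=> [q _ /= [<-]].
  apply: countable_bigcupT_measurable => [|q]; first exact: countableP.
  apply: measurableI; first exact: measurable_grid_cell.
  have mq := mPhi (rep k q) measurableT Y mY; rewrite setTI in mq.
  by have := ms measurableT _ mq; rewrite setTI.
- move=> w _; apply/cvgrPdist_lt => e e0.
  have [r r0 H1] := cPhi w (s w) e e0.
  near=> k; rewrite distrC; apply: H1.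
  apply: le_lt_trans (grid_cell_close (repE k w)) _.
  by near: k; exact: near_infty_natSinv_lt (PosNum r0).
Unshelve. all: by end_near. Qed.

Lemma measurable_continuous_comp d (H : measurableType d) (v : H -> 'rV[R]_n)
    (phi : 'rV[R]_n -> R) :
  (forall j, measurable_fun setT (fun w => v w 0 j)) -> continuous phi ->
  measurable_fun setT (fun w => phi (v w)).
Proof.
move=> mv cphi.
apply: (@measurable_caratheodory _ H _ H v id (fun w _ => phi (v w))) => //.
move=> w _ e e0; have /cvgrPdist_lt/(_ e e0) := cphi (v w).
rewrite -filter_from_ballE => -[r /= r0 H1]; exists r => // w' vw.
by rewrite distrC; apply: H1; rewrite -ball_normE/= distrC.
Qed.

(** The function [h] need not be given as a composite: its increments are
    controlled by those of [v]. *)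
Lemma measurable_lipschitz_comp d (H : measurableType d)
    (v : H -> 'rV[R]_n) (h : H -> R) (L : R) :
  (forall j, measurable_fun setT (fun w => v w 0 j)) ->
  (forall w w', `|h w - h w'| <= L * enorm (v w - v w')) ->
  measurable_fun setT h.
Proof.
move=> mv hL.
apply: (@measurable_caratheodory _ H _ H v id (fun w _ => h w)) => //.
move=> w _ e e0; have A : 0 < `|L| * n%:R + 1 by rewrite ltr_wpDl// mulr_ge0.
exists (e / (`|L| * n%:R + 1)); first by rewrite divr_gt0.
move=> w'; rewrite ltr_pdivlMr// => vw; apply: le_lt_trans (hL _ _) _.
apply: le_lt_trans vw.
apply: (@le_trans _ _ (`|L| * (n%:R * `|v w' - v w|))).
  apply: (@le_trans _ _ (`|L| * enorm (v w' - v w))).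
    by rewrite ler_wpM2r ?enorm_ge0 ?ler_norm.
  by rewrite ler_wpM2l ?enorm_le_norm.
by rewrite mulrA [leRHS]mulrC ler_wpM2r// lerDl.
Qed.

End Discretize.

Section MeasurableGradient.
Context (R : realType) (n : nat) d (S : measurableType d)
  (phi : 'rV[R]_n -> S -> R).
Hypothesis phiC1 : forall s, C1 (phi ^~ s).
Hypothesis mphi : forall x, measurable_fun setT (phi x).

(** The partial derivative is the limit of the difference quotients of step
    [harmonic k], each of which is measurable. *)
Lemma measurable_grad_sample (x : 'rV[R]_n) j :
  measurable_fun setT (fun s => grad (phi ^~ s) x 0 j).
Proof.
pose q k s :=
  (harmonic k)^-1 * (phi (harmonic k *: delta_mx 0 j + x) s - phi x s).
apply: (@measurable_fun_cvg _ _ _ _ q).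
  by move=> k; apply: measurable_funM => //; exact: measurable_funB.
move=> s _; rewrite /= mxE.
have D := diff_derivable (v := delta_mx 0 j) ((phiC1 s).1 x).
apply: ((cvgr_dnbhsP _ _ _).1 D harmonic); split => [k|]; last exact: cvg_harmonic.
by rewrite gt_eqF// harmonic_gt0.
Qed.

Lemma measurable_grad_comp d1 (H : measurableType d1) (v : H -> 'rV[R]_n)
    (s : H -> S) j :
  (forall j, measurable_fun setT (fun w => v w 0 j)) -> measurable_fun setT s ->
  measurable_fun setT (fun w => grad (phi ^~ (s w)) (v w) 0 j).
Proof.
move=> mv ms.
apply: (@measurable_caratheodory _ _ _ _ _ _ v s
  (fun w t => grad (phi ^~ t) (v w) 0 j)) => //.
  by move=> w; exact: measurable_grad_sample.
move=> w t e e0; have /cvgrPdist_lt/(_ e e0) := (phiC1 t).2 (v w).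
rewrite -filter_from_ballE => -[r /= r0 H1]; exists r => // w' vw.
have : `|grad (phi ^~ t) (v w) - grad (phi ^~ t) (v w')| < e.
  by apply: H1; rewrite -ball_normE/= distrC.
rewrite distrC; apply: le_lt_trans.
apply: le_trans (coord_le_norm _ j).
by rewrite !mxE.
Qed.

End MeasurableGradient.

(** * Expectations of bounded random variables *)

Section BoundedMeasurable.
Context (R : realType) d (H : measurableType d).
Implicit Types h : H -> R.

Definition bounded_measurable h :=
  measurable_fun setT h /\ exists M : R, forall w, `|h w| <= M.

Lemma bounded_measurable_integrable (mu : probability H R) h :
  bounded_measurable h -> mu.-integrable setT (EFin \o h).
Proof.
move=> [mh [M hM]]; apply: measurable_bounded_integrable => //.
  by rewrite -[X in (X < _)%E]/(mu [set: H]) (probability_setT mu) ltry.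
exists M; split; first exact: num_real.
by move=> x Mx w _ /=; rewrite (le_trans (hM w))// ltW.
Qed.

Lemma bounded_measurable_cst r : bounded_measurable (fun=> r).
Proof. by split => //; exists `|r|. Qed.

Lemma bounded_measurableD h1 h2 : bounded_measurable h1 ->
  bounded_measurable h2 -> bounded_measurable (fun w => h1 w + h2 w).
Proof.
move=> [m1 [M1 b1]] [m2 [M2 b2]]; split; first exact: measurable_funD.
by exists (M1 + M2) => w; rewrite (le_trans (ler_normD _ _))// lerD.
Qed.

Lemma bounded_measurableM h1 h2 : bounded_measurable h1 ->
  bounded_measurable h2 -> bounded_measurable (fun w => h1 w * h2 w).
Proof.
move=> [m1 [M1 b1]] [m2 [M2 b2]]; split; first exact: measurable_funM.
by exists (M1 * M2) => w; rewrite normrM ler_pM.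
Qed.

Lemma bounded_measurableZ r h :
  bounded_measurable h -> bounded_measurable (fun w => r * h w).
Proof. by apply: bounded_measurableM; exact: bounded_measurable_cst. Qed.

Lemma bounded_measurable_sum (I : eqType) (s : seq I) (h : I -> H -> R) :
  (forall i, i \in s -> bounded_measurable (h i)) ->
  bounded_measurable (fun w => \sum_(i <- s) h i w).
Proof.
elim: s => [|i s IH] bh.
  by under eq_fun do rewrite big_nil; exact: bounded_measurable_cst.
under eq_fun do rewrite big_cons.
apply: bounded_measurableD; first by apply: bh; rewrite mem_head.
by apply: IH => j js; apply: bh; rewrite inE js orbT.
Qed.

Context (mu : probability H R).

Lemma Rintegral_bmD h1 h2 : bounded_measurable h1 -> bounded_measurable h2 ->
  \int[mu]_w (h1 w + h2 w) = \int[mu]_w h1 w + \int[mu]_w h2 w.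
Proof.
by move=> b1 b2; rewrite RintegralD//; exact: bounded_measurable_integrable.
Qed.

Lemma Rintegral_bmZ r h : bounded_measurable h ->
  \int[mu]_w (r * h w) = r * \int[mu]_w h w.
Proof.
by move=> b1; rewrite RintegralZl//; exact: bounded_measurable_integrable.
Qed.

Lemma Rintegral_prob_cst r : \int[mu]_w r = r.
Proof. by rewrite Rintegral_cst//= probability_setT mulr1. Qed.

Lemma Rintegral_bm_sum (I : eqType) (s : seq I) (h : I -> H -> R) :
  (forall i, i \in s -> bounded_measurable (h i)) ->
  \int[mu]_w (\sum_(i <- s) h i w) = \sum_(i <- s) \int[mu]_w h i w.
Proof.
elim: s => [|i s IH] bh.
  under eq_Rintegral do rewrite big_nil.
  by rewrite big_nil Rintegral_prob_cst.
under eq_Rintegral do rewrite big_cons.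
have bs j : j \in s -> bounded_measurable (h j).
  by move=> js; apply: bh; rewrite inE js orbT.
rewrite big_cons -IH// Rintegral_bmD//; first by apply: bh; rewrite mem_head.
exact: bounded_measurable_sum.
Qed.

Lemma le_Rintegral_bm h1 h2 : bounded_measurable h1 -> bounded_measurable h2 ->
  (forall w, h1 w <= h2 w) -> \int[mu]_w h1 w <= \int[mu]_w h2 w.
Proof.
by move=> b1 b2 h12; apply: le_Rintegral => //; exact: bounded_measurable_integrable.
Qed.

Lemma EFin_Rintegral_bm h : bounded_measurable h ->
  (\int[mu]_w (h w)%:E)%E = (\int[mu]_w h w)%:E.
Proof.
move=> b; rewrite /Rintegral fineK// integrable_fin_num//.
exact: bounded_measurable_integrable.
Qed.

(** The integral of a function of either sign is the difference of two suprema
    over simple functions, so it is monotone without measurability. *)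
Lemma le_integral_nonmeasurable (f1 f2 : H -> \bar R) :
  (forall w, (f1 w <= f2 w)%E) ->
  (\int[mu]_w f1 w <= \int[mu]_w f2 w)%E.
Proof.
move=> f12; rewrite /integral !patch_setT; apply: leeB.
- apply: ereal_sup_le => _ [h hf <-]; exists h => // w.
  apply: le_trans (hf w) _; exact: (@funepos_le _ _ setT f1 f2 (fun x _ => f12 x) w (in_setT _)).
- apply: ereal_sup_le => _ [h hf <-]; exists h => // w.
  apply: le_trans (hf w) _; exact: (@funeneg_le _ _ setT f1 f2 (fun x _ => f12 x) w (in_setT _)).
Qed.

End BoundedMeasurable.

(** * Independent samples *)

Section Independence.
Context (R : realType) d d' (T : measurableType d) (P : probability T R)
  (Xi : measurableType d').

(** The law of the pair is the product of the laws of [a] and [b], so Fubini's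
    theorem integrates [b] first, with [a] frozen. *)
Lemma independent_Rintegral_le dH (H : measurableType dH) (a : {RV P >-> H})
    (b : {RV P >-> Xi}) (mu : probability Xi R) (Psi : H * Xi -> R) (C : R) :
  (forall A B, measurable A -> measurable B ->
     P (a @^-1` A `&` b @^-1` B) = (P (a @^-1` A) * mu B)%E) ->
  bounded_measurable Psi ->
  (forall h, \int[mu]_s Psi (h, s) <= C) ->
  \int[P]_w Psi (a w, b w) <= C.
Proof.
move=> ind bPsi PsiC.
have mab : measurable_fun setT (fun w => (a w, b w)).
  by apply: measurable_fun_pair; exact: measurable_funP.
pose ab : {RV P >-> (H * Xi)%type} :=
  HB.pack (fun w => (a w, b w)) (isMeasurableFun.Build _ _ _ _ _ mab).
have bab : bounded_measurable (fun w => Psi (a w, b w)).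
  case: bPsi => mPsi [M PsiM]; split; last by exists M.
  exact: (measurableT_comp mPsi mab).
have b1 h : bounded_measurable (fun s => Psi (h, s)).
  case: bPsi => mPsi [M PsiM]; split; last by exists M.
  exact: measurable_fun_pair2.
rewrite -lee_fin -EFin_Rintegral_bm//.
have -> : (\int[P]_w (Psi (a w, b w))%:E)%E =
    (\int[distribution P ab]_z (Psi z)%:E)%E.
  rewrite integral_distribution//; first by apply/measurable_EFinP; case: bPsi.
  exact: (bounded_measurable_integrable P bab).
have E A : measurable A -> (distribution P a \x mu)%E A = distribution P ab A.
  apply: product_measure_unique => A1 B1 mA1 mB1.
  by rewrite -ind.
rewrite -(eq_measure_integral _ (fun A mA _ => E A mA)).
have iPsi : (distribution P a \x mu)%E.-integrable setT (EFin \o Psi).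
  case: bPsi => mPsi [M PsiM]; apply: measurable_bounded_integrable => //.
    suff : ((distribution P a \x mu)%E setT < +oo)%E by [].
    by rewrite E// (le_lt_trans (probability_le1 _ _) (ltry _)).
  exists M; split; first exact: num_real.
  by move=> x Mx w _ /=; rewrite (le_trans (PsiM w))// ltW.
rewrite -(integral12_prod_meas1 iPsi).
rewrite -[leRHS](_ : \int[distribution P a]_x C%:E = _)%E; last first.
  by rewrite integral_cst//= probability_setT mule1.
apply: le_integral => //; first exact: integrable_fubini_F.
  exact: (bounded_measurable_integrable _ (bounded_measurable_cst _ _)).
by move=> h _; rewrite /fubini_F EFin_Rintegral_bm// lee_fin.
Qed.

Context (xis : nat -> {RV P >-> Xi}).

(** Finite intersections of events on the first [k] samples: a pi-system that
    generates the history of these samples. *)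
Definition past_events (k : nat) : set (set T) :=
  [set B | exists2 A : nat -> set Xi, (forall j, measurable (A j)) &
     B = \bigcap_(j in [set` iota 1 k]) (xis j @^-1` A j)].

Definition pastT k : measurableType _ := g_sigma_algebraType (past_events k).

Lemma past_events_measurable k : past_events k `<=` measurable.
Proof.
move=> _ [A mA ->]; apply: fin_bigcap_measurable; first exact: finite_seq.
by move=> j _; rewrite -[X in measurable X]setTI; exact: measurable_funP.
Qed.

Lemma past_measurable k : <<s past_events k >> `<=` measurable.
Proof.
apply: smallest_sub; first exact: sigma_algebra_measurable.
exact: past_events_measurable.
Qed.

Lemma past_events_setI k : setI_closed (past_events k).
Proof.
move=> _ _ [A mA ->] [B mB ->]; exists (fun j => A j `&` B j).
  by move=> j; exact: measurableI.
rewrite -bigcapI; apply: eq_bigcapr => j _.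
by rewrite preimage_setI.
Qed.

Lemma sample_indexE k : [set` iota 1 k] = [set j | (1 <= j <= k)%N].
Proof. by apply/seteqP; split => j; rewrite /= mem_iota add1n ltnS. Qed.

Lemma past_eventsS k : past_events k `<=` past_events k.+1.
Proof.
move=> _ [A mA ->]; exists (fun j => if (j <= k)%N then A j else setT).
  by move=> j; case: ifP.
rewrite !sample_indexE; apply/seteqP; split => w wA j /= /andP[j1 jk].
  by case: ifP => // jk'; apply: wA; rewrite /= j1.
by have := wA j; rewrite /= j1 jk (leqW jk); exact.
Qed.

Lemma past_eventT k : past_events k setT.
Proof. by exists (fun=> setT) => //; rewrite bigcapT. Qed.

Lemma pastT_id k : measurable_fun setT (idfun : T -> pastT k).
Proof. by move=> _ A mA; rewrite setTI; exact: (@past_measurable k A mA). Qed.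

Definition pastT_RV k : {RV P >-> pastT k} :=
  HB.pack (idfun : T -> pastT k) (isMeasurableFun.Build _ _ _ _ _ (@pastT_id k)).

Lemma measurable_pastS k d1 (Y : measurableType d1) (h : T -> Y) :
  measurable_fun setT (h : pastT k -> Y) ->
  measurable_fun setT (h : pastT k.+1 -> Y).
Proof.
move=> mh _ A mA; have := mh measurableT A mA.
by apply: sub_smallest2r; [exact: smallest_sigma_algebra|exact: past_eventsS].
Qed.

Lemma measurable_past k d1 (Y : measurableType d1) (h : T -> Y) :
  measurable_fun setT (h : pastT k -> Y) -> measurable_fun setT h.
Proof. by move=> mh _ A mA; apply: past_measurable (mh measurableT A mA). Qed.

Lemma measurable_sample k : measurable_fun setT (xis k.+1 : pastT k.+1 -> Xi).
Proof.
move=> _ A mA; rewrite setTI; apply: sub_sigma_algebra.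
exists (fun j => if j == k.+1 then A else setT) => [j|]; first by case: ifP.
rewrite sample_indexE; apply/seteqP; split => w.
  by move=> wA j /= _; case: ifP => // /eqP ->.
by move=> /(_ k.+1); rewrite /= eqxx; apply; rewrite leqnn.
Qed.

Hypothesis indep : mutually_independent [set k | (1 <= k)%N] xis.

(** The product rule extends from past events to the sigma-algebra that they
    generate, two finite measures equal on a pi-system being equal on the
    generated sigma-algebra. *)
Lemma past_independent k A B : <<s past_events k >> A -> measurable B ->
  P (A `&` xis k.+1 @^-1` B) = (P A * P (xis k.+1 @^-1` B))%E.
Proof.
move=> sA mB; set C := xis k.+1 @^-1` B.
have mC : measurable C by rewrite -[C]setTI; exact: measurable_funP.
have PC : P C = (fine (P C))%:E by rewrite fineK// fin_num_measure.
have PC0 : 0 <= fine (P C) by rewrite fine_ge0.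
transitivity (mrestr P mC A); first by [].
transitivity (mscale (NngNum PC0) P A); last by rewrite /mscale/= -PC muleC.
apply: (g_sigma_algebra_measure_unique (past_events k) _ (fun=> setT)) => //.
- exact: past_events_measurable.
- by move=> i; exact: past_eventT.
- by rewrite bigcup_const.
- exact: past_events_setI.
- move=> _ [D mD ->].
  set BD := \bigcap_(j in _) _.
  change (P (BD `&` C) = (fine (P C))%:E * P BD)%E; rewrite -PC muleC {}/BD.
  (* the sample of index k.+1 becomes one more factor of the product rule *)
  pose D' j := if j == k.+1 then B else D j.
  have mD' j : measurable (D' j) by rewrite /D'; case: ifP.
  have H s : uniq s -> (forall j, j \in s -> (1 <= j)%N) ->
      P (\bigcap_(j in [set` s]) (xis j @^-1` D' j)) =
      (\prod_(j <- s) P (xis j @^-1` D' j))%E.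
    by move=> us s1; apply: indep.
  have D'D j : j \in iota 1 k -> D' j = D j.
    by rewrite mem_iota add1n ltnS /D' => /andP[_ jk]; rewrite ltn_eqF.
  have -> : \bigcap_(j in [set` iota 1 k]) (xis j @^-1` D j) =
      \bigcap_(j in [set` iota 1 k]) (xis j @^-1` D' j).
    by apply: eq_bigcapr => j /= jk; rewrite D'D.
  have C' : C = xis k.+1 @^-1` D' k.+1 by rewrite /D' eqxx.
  have -> : \bigcap_(j in [set` iota 1 k]) (xis j @^-1` D' j) `&` C =
      \bigcap_(j in [set` rcons (iota 1 k) k.+1]) (xis j @^-1` D' j).
    apply/seteqP; split => w /=.
      move=> [wA wC] j /=; rewrite mem_rcons inE => /orP[/eqP ->|/wA//].
      by move: wC; rewrite C'.
    move=> wA; split; last by rewrite C'; apply: wA; rewrite /= mem_rcons mem_head.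
    by move=> j jk; apply: wA; rewrite /= mem_rcons inE (jk : is_true _) orbT.
  rewrite H; last 2 first.
  + by rewrite rcons_uniq iota_uniq mem_iota add1n ltnn andbF.
  + by move=> j; rewrite mem_rcons inE mem_iota => /orP[/eqP->|/andP[]].
  rewrite H ?iota_uniq//; last by move=> j; rewrite mem_iota => /andP[].
  by rewrite -cats1 big_cat big_seq1 /= -C'.
- move=> i; change (P (setT `&` C) < +oo)%E; rewrite setTI; exact: (le_lt_trans (probability_le1 _ mC) (ltry _)).
Qed.

(** The past is the identity map from [T] to [T] with the sigma-algebra of the
    first [k] samples; it is independent of the sample of index [k.+1], which
    has the law of [xi]. *)
Lemma sample_Rintegral_le k (xi : {RV P >-> Xi}) (Psi : T -> Xi -> R) (C : R) :
  same_law (xis k.+1) xi ->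
  bounded_measurable (fun p : pastT k * Xi => Psi p.1 p.2) ->
  (forall w, \int[P]_w' Psi w (xi w') <= C) ->
  \int[P]_w Psi w (xis k.+1 w) <= C.
Proof.
move=> law bPsi PsiC.
apply: (@independent_Rintegral_le _ (pastT k) (pastT_RV k) (xis k.+1)
  (distribution P xi) (fun p => Psi p.1 p.2)) => //.
  move=> A B sA mB; have := past_independent sA mB.
  by rewrite -[P (xis k.+1 @^-1` B)]/(distribution P (xis k.+1) B) law.
move=> h; have := PsiC h.
have b1 : bounded_measurable (Psi h).
  case: bPsi => mPsi [M PsiM]; split; last by exists M => s; exact: (PsiM (h, s)).
  exact: (measurable_fun_pair2 h mPsi).
rewrite /Rintegral integral_distribution//; first by apply/measurable_EFinP; case: b1.
apply: bounded_measurable_integrable.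
case: b1 => m1 [M PsiM]; split; last by exists M.
exact: (measurableT_comp m1 (measurable_funP xi)).
Qed.

End Independence.

(** * The expected objective *)

Section Expected.
Context (R : realType) (n : nat) (d d' : measure_display)
  (T : measurableType d) (P : probability T R) (Xi : measurableType d')
  (xi : {RV P >-> Xi}) (ftilde : 'rV[R]_n -> Xi -> R).
Let f := expected_fun ftilde xi.

Lemma expected_fun_convex :
  (forall s, convex_fun (fun x => ftilde x s)) ->
  (forall x, P.-integrable setT (fun w => (ftilde x (xi w))%:E)) ->
  convex_fun f.
Proof.
move=> cf intf t x y _ _; rewrite /f /expected_fun !unlock.
set p := conv t _ _.
change (\int[P]_w ftilde p (xi w) <=
  t%:num * (\int[P]_w ftilde x (xi w)) + (1 - t%:num) * (\int[P]_w ftilde y (xi w))).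
have iZ (r : R) v : P.-integrable setT (EFin \o (fun w => r * ftilde v (xi w))).
  by have := integrableZl measurableT r (intf v); apply: eq_integrable.
rewrite -(RintegralZl _ _ (intf x))// -(RintegralZl _ _ (intf y))//.
rewrite -RintegralD//.
apply: le_Rintegral => //.
- exact: (intf p).
- have := integrableD measurableT (iZ t%:num x) (iZ (1 - t%:num) y).
  exact: eq_integrable.
- by move=> w _; exact: (cf (xi w) t x y (in_setT _) (in_setT _)).
Qed.

Hypothesis hf_C1 : forall s, C1 (fun x => ftilde x s).
Hypothesis hf_meas : forall x, measurable_fun setT (ftilde x).
Context (x : 'rV[R]_n) (G : R).
Hypothesis hf_unbiased : forall j,
  ('E_P[fun w => (grad (fun u => ftilde u (xi w)) x 0 j)%R] =
     (grad f x 0 j)%:E)%E.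
Hypothesis hf_bound : forall s, enorm (grad (fun u => ftilde u s) x) <= G.

Lemma bounded_measurable_grad_sample j :
  bounded_measurable (fun w => grad (fun u => ftilde u (xi w)) x 0 j).
Proof.
split; last by exists G => w; rewrite (le_trans (coord_le_enorm _ _)).
by apply: measurable_grad_comp => //; exact: measurable_funP.
Qed.

Lemma unbiased_dotv v :
  \int[P]_w dotv (grad (fun u => ftilde u (xi w)) x) v = dotv (grad f x) v.
Proof.
rewrite /dotv Rintegral_bm_sum; last first.
  move=> j _; apply: bounded_measurableM; last exact: bounded_measurable_cst.
  exact: bounded_measurable_grad_sample.
apply: eq_bigr => j _; rewrite RintegralZr//; last first.
  apply: bounded_measurable_integrable; exact: bounded_measurable_grad_sample.
by have := hf_unbiased j; rewrite unlock /Rintegral => ->.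
Qed.

Lemma bounded_measurable_dotv_grad_sample v :
  bounded_measurable (fun w => dotv (grad (fun u => ftilde u (xi w)) x) v).
Proof.
apply: bounded_measurable_sum => j _.
apply: bounded_measurableM; last exact: bounded_measurable_cst.
exact: bounded_measurable_grad_sample.
Qed.

(** Jensen's inequality for the norm, in the form |g|^2 = E <g_sample, g> <= G |g|
    where g is the mean gradient. *)
Lemma enorm_grad_expected : enorm (grad f x) <= G.
Proof.
set g := grad f x.
have : enorm g ^+ 2 <= G * enorm g.
  rewrite enormE -unbiased_dotv -[leRHS](Rintegral_prob_cst P).
  apply: le_Rintegral_bm.
  - exact: bounded_measurable_dotv_grad_sample.
  - exact: bounded_measurable_cst.
  - move=> w; apply: le_trans (cauchy_schwarz _ _) _.
    by rewrite ler_wpM2r ?enorm_ge0.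
have [->|g0] := eqVneq (enorm g) 0.
  by rewrite (le_trans (enorm_ge0 _) (hf_bound (xi point))).
by rewrite expr2 ler_pM2r// lt_def g0 enorm_ge0.
Qed.

End Expected.

(** * Sample paths of the method *)

Section Path.
Context (R : realType) (n m : nat) (d' : measure_display)
  (Xi : measurableType d') (ftilde : 'rV[R]_n -> Xi -> R)
  (psi : 'rV[R]_n -> \bar R) (c : 'rV[R]_n -> 'rV[R]_m) (f : 'rV[R]_n -> R).
Let X := dom psi.
Hypothesis hpsi : proper_closed_convex psi.
Hypothesis hf_convex : convex_fun f.
Hypothesis hc_convex : forall i, convex_fun (fun x => c x 0 i).
Context (Lf : R) (Lc Lgc C : 'I_m -> R).
Hypothesis hf_smooth : smooth_on Lf X f.
Hypothesis hc_lip : forall i, elipschitz_on (Lc i) X (fun x => c x 0 i).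
Hypothesis hc_smooth : forall i, smooth_on (Lgc i) X (fun x => c x 0 i).
Hypothesis hc_bound : forall i x, X x -> `|c x 0 i| <= C i.
Let Lc2 := smoothness_c2 Lc Lgc C.
Context (DX : R).
Hypothesis hDX : forall x y, X x -> X y -> enorm (x - y) <= DX.

Definition penalized (rh : R) x := f x + rh * penalty c x + fine (psi x).

Context (x1 : 'rV[R]_n) (beta gamma rho : nat -> R) (s : nat -> Xi)
  (x y z g : nat -> 'rV[R]_n).
Hypothesis hx1 : X x1.
Hypothesis hbeta1 : forall k, (1 <= k)%N -> 1 <= beta k.
Hypothesis hgamma0 : forall k, (1 <= k)%N -> 0 < gamma k.
Hypothesis hrun : algorithm_run ftilde psi c x1 beta gamma rho s x y z g.

Lemma run_dom k : (1 <= k)%N -> X (x k) /\ X (z k).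
Proof.
case: k => // k _; elim: k => [|k [Xx Xz]].
  by rewrite (run_x1 hrun) (run_z1 hrun).
have Xz' : X (z k.+2).
  exact: (prox_dom hpsi (hgamma0 (ltn0Sn k)) (run_z hrun (ltn0Sn k))).
split => //; rewrite (run_x hrun)// addrC.
rewrite -{2}[(beta k.+1)^-1](subKr 1) subKr; apply: (dom_segment hpsi) => //.
  by rewrite invr_ge0 (le_trans ler01) ?hbeta1.
by rewrite invf_le1 ?hbeta1// (lt_le_trans ltr01) ?hbeta1.
Qed.

Lemma run_y_dom k : (1 <= k)%N -> X (y k).
Proof.
move=> k1; have [Xx Xz] := run_dom k1.
rewrite (run_y hrun)// addrC; apply: (dom_segment hpsi) => //.
  by rewrite invr_ge0 (le_trans ler01) ?hbeta1.
by rewrite invf_le1 ?hbeta1// (lt_le_trans ltr01) ?hbeta1.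
Qed.

Definition noise k := grad (fun u => ftilde u (s k)) (y k) - grad f (y k).

Context (K : nat) (rh : R).
Let L := Lf + rh * Lc2.
Hypothesis rh0 : 0 < rh.
Hypothesis L0 : 0 < L.
Hypothesis hrho : forall k, (1 <= k < K)%N -> rho k = rh.
Hypothesis hbeta : forall k, (1 <= k < K)%N -> beta k = k.+1%:R / 2.
Hypothesis hgamma : forall k, (1 <= k < K)%N -> gamma k = k.+1%:R / (4 * L).

(** The step inequality with th = 2 / (k + 1) and gamma = (k + 1) / (4 L),
    multiplied by k (k + 1). The term in |z_{k+1} - z_k|^2 keeps half of what the
    proximal inequality provides. *)
Lemma run_step k u : (1 <= k < K)%N -> X u ->
  k%:R * k.+1%:R * (penalized rh (x k.+1) - penalized rh u) <=
  k%:R * (k%:R - 1) * (penalized rh (x k) - penalized rh u)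
  + 4 * L * (k%:R / k.+1%:R) * (enorm (u - z k) ^+ 2 - enorm (u - z k.+1) ^+ 2)
  + (2 * k%:R * dotv (noise k) (u - z k.+1)
     - 2 * L * (k%:R / k.+1%:R) * enorm (z k.+1 - z k) ^+ 2).
Proof.
move=> kK Xu; have k1 : (1 <= k)%N by case/andP: kK.
have [Xx Xz] := run_dom k1; have [Xx' Xz'] := run_dom (ltn0Sn k).
have Xy := run_y_dom k1.
have b1 := hbeta1 k1; have g0 := hgamma0 k1.
set p := grad f (y k) + rh *: penalty_grad c (y k).
pose h x := f x + rh * penalty c x.
have hL v : X v -> h (y k) + dotv p (v - y k) <= h v.
  move=> Xv; have H1 := convex_gradient_ineq v hf_convex (hf_smooth.1 _ Xy).
  have := penalty_gradient_ineq v hc_convex (fun i => (hc_smooth i).1 _ Xy).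
  move=> /(ler_wpM2l (ltW rh0)) H2.
  rewrite /h /p dotvDl dotvZl; lra.
have hU v : X v ->
    h v <= h (y k) + dotv p (v - y k) + L / 2 * enorm (v - y k) ^+ 2.
  move=> Xv; have H1 := descent_lemma (dom_segment hpsi) hf_smooth Xv Xy.
  have := penalty_descent (dom_segment hpsi) hc_lip hc_smooth hc_bound Xv Xy.
  move=> /(ler_wpM2l (ltW rh0)) H2.
  rewrite /h /p /L /Lc2 dotvDl dotvZl; lra.
have ib0 : 0 <= (beta k)^-1 by rewrite invr_ge0 (le_trans ler01).
have ib1 : (beta k)^-1 <= 1 by rewrite invf_le1// (lt_le_trans ltr01).
have gE : g k = p + noise k.
  by rewrite (run_g hrun)// hrho// /p /noise [RHS]addrC addrA subrK.
have Hp := prox_variational hpsi g0 (run_z hrun k1) Xu; rewrite gE in Hp.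
have Hs : fine (psi (x k.+1)) <=
    (1 - (beta k)^-1) * fine (psi (x k)) + (beta k)^-1 * fine (psi (z k.+1)).
  rewrite (run_x hrun)// addrC [leRHS]addrC.
  exact: (fine_pcc_convex hpsi).
have := accelerated_step (h := h) (psi := fun v => fine (psi v)) ib0 ib1 g0 (run_y hrun k1) (run_x hrun k1)
  (hL _ Xx) (hL _ Xu) (hU _ Xx') Hs Hp.
rewrite -/(penalized rh (x k.+1)) -/(penalized rh (x k)) -/(penalized rh u).
rewrite hbeta// hgamma//.
set A' := _ - penalized rh u; set A := penalized rh (x k) - _.
set D := enorm (u - z k) ^+ 2; set D' := enorm (u - z k.+1) ^+ 2.
set E := enorm (_ - _) ^+ 2; set N := dotv _ _.
have t0 : k.+1%:R != 0 :> R by rewrite pnatr_eq0.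
have L0' : L != 0 by rewrite gt_eqF.
move=> /(ler_wpM2l (mulr_ge0 (ler0n R k) (ler0n R k.+1))) H.
apply: le_trans H _; rewrite le_eqVlt; apply/orP; left; apply/eqP.
have -> : k%:R = k.+1%:R - 1 :> R by rewrite -natr1 addrK.
set t := k.+1%:R in t0 *; move: t t0 => t t0; move: (L) L0' => l l0.
by field; rewrite t0 l0.
Qed.

Hypothesis hK : (2 <= K)%N.

(** Telescoping with the weights [k (k + 1)]; the sum of the distance terms is
    controlled by the diameter since its coefficients increase. *)
Lemma run_bound u (N : nat -> R) : X u ->
  (forall k, (1 <= k < K)%N -> 2 * k%:R * dotv (noise k) (u - z k.+1)
     - 2 * L * (k%:R / k.+1%:R) * enorm (z k.+1 - z k) ^+ 2 <= N k) ->
  penalized rh (x K) - penalized rh u <=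
    4 * L * DX ^+ 2 / K%:R ^+ 2
    + (\sum_(1 <= k < K) N k) / (K%:R * (K%:R - 1)).
Proof.
move=> Xu hN.
have H : K%:R * (K%:R - 1) * (penalized rh (x K) - penalized rh u) <=
    4 * L * ((K%:R - 1) / K%:R) * (DX ^+ 2 - enorm (u - z K) ^+ 2)
    + \sum_(1 <= j < K) N j.
  apply: (@accelerated_telescope R L (DX ^+ 2)
    (fun k => penalized rh (x k) - penalized rh u)
    (fun k => enorm (u - z k) ^+ 2) N K (ltW L0)).
  - move=> k k1; have [_ Xz] := run_dom k1.
    by rewrite lerXn2r ?nnegrE ?enorm_ge0 ?hDX// (le_trans _ (hDX Xu Xu))// enorm_ge0.
  - by move=> k kK; apply: le_trans (run_step kK Xu) _; rewrite lerD2l hN.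
  - by rewrite (ltnW hK) leqnn.
have K2 : 2 <= K%:R :> R by rewrite ler_nat.
set S := \sum_(_ <= _ < _) _ in H *.
have t0 : 0 < K%:R :> R by lra.
have t1 : 0 < K%:R - 1 :> R by lra.
have K1 : 0 < K%:R * (K%:R - 1) :> R by rewrite mulr_gt0.
rewrite -(ler_pM2l K1); apply: le_trans H _.
have -> : K%:R * (K%:R - 1) * (4 * L * DX ^+ 2 / K%:R ^+ 2 + S / (K%:R * (K%:R - 1)))
  = 4 * L * ((K%:R - 1) / K%:R) * DX ^+ 2 + S.
  by field; rewrite !gt_eqF.
rewrite lerD2r ler_wpM2l//; last by rewrite gerBl sqr_ge0.
by rewrite !mulr_ge0 ?invr_ge0// ltW.
Qed.

(** Both the sampled and the mean gradients are bounded by [G], so that each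
    noise term is at most 2 G DX whatever the samples are. *)
Lemma run_bound_surely u G : X u ->
  (forall v t, X v -> enorm (grad (fun u => ftilde u t) v) <= G) ->
  (forall v, X v -> enorm (grad f v) <= G) ->
  penalized rh (x K) - penalized rh u <=
    4 * L * DX ^+ 2 / K%:R ^+ 2 + 2 * G * DX.
Proof.
move=> Xu G1 G2.
have hN k : (1 <= k < K)%N -> 2 * k%:R * dotv (noise k) (u - z k.+1)
     - 2 * L * (k%:R / k.+1%:R) * enorm (z k.+1 - z k) ^+ 2
     <= 2 * k%:R * (2 * G * DX).
  move=> kK; have k1 : (1 <= k)%N by case/andP: kK.
  have [_ Xz'] := run_dom (ltn0Sn k); have Xy := run_y_dom k1.
  rewrite lerBlDr ler_wpDr//.
    apply: mulr_ge0; last exact: sqr_ge0.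
    by rewrite mulr_ge0 ?divr_ge0// mulr_ge0// ltW.
  rewrite ler_wpM2l ?mulr_ge0//; apply: le_trans (cauchy_schwarz _ _) _.
  rewrite ler_pM ?enorm_ge0 ?hDX//; apply: le_trans (enormB _ _) _.
  by have := G1 _ (s k) Xy; have := G2 _ Xy; lra.
apply: le_trans (run_bound Xu hN) _; rewrite lerD2l -mulr_suml.
have K2 : 2 <= K%:R :> R by rewrite ler_nat.
have -> : \sum_(1 <= k < K) (2 * k%:R) = K%:R * (K%:R - 1) :> R.
  elim: (K) => [|k IH]; first by rewrite big_geq// mul0r.
  case: k IH => [|k] IH; first by rewrite big_geq// subrr mulr0.
  by rewrite big_nat_recr//= IH -(natr1 k.+1); ring.
by rewrite mulrAC mulfV ?mul1r// mulf_neq0//; lra.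
Qed.

(** The displacement [z k.+1 - z k] is paid for by the spare part of the
    quadratic term. If [Lf] is negative then [X] is a single point, so that the
    displacement vanishes. *)
Lemma run_bound_noise u : X u -> 0 < Lc2 ->
  penalized rh (x K) - penalized rh u <=
    4 * L * DX ^+ 2 / K%:R ^+ 2
    + (\sum_(1 <= k < K) (2 * k%:R * dotv (noise k) (u - z k)
         + k%:R * k.+1%:R / (2 * (rh * Lc2)) * enorm (noise k) ^+ 2))
      / (K%:R * (K%:R - 1)).
Proof.
move=> Xu Lc20; apply: run_bound => // k kK.
have k1 : (1 <= k)%N by case/andP: kK.
have [_ Xz] := run_dom k1; have [_ Xz'] := run_dom (ltn0Sn k).
set M := rh * Lc2; have M0 : 0 < M by rewrite mulr_gt0.
have t0 : 0 < k.+1%:R :> R by [].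
have -> : u - z k.+1 = (u - z k) - (z k.+1 - z k).
  by rewrite opprB addrA subrK.
set D := z k.+1 - z k; set nu := noise k.
suff : - (2 * dotv nu D) <=
    2 * L / k.+1%:R * enorm D ^+ 2 + k.+1%:R / (2 * M) * enorm nu ^+ 2.
  move=> /(ler_wpM2l (ler0n R k)); rewrite dotvBr -[k%:R * k.+1%:R / _]mulrA.
  set i := k.+1%:R / _; set it := k.+1%:R^-1; move: i it => i it; lra.
have [Lf0|Lf0] := leP 0 Lf.
  have a0 : 0 < 2 * M / k.+1%:R by rewrite divr_gt0// mulr_gt0.
  have := young_dotv D (- nu) a0; rewrite enormN dotvNr dotvC invf_div mulrN.
  move=> H; apply: le_trans H _; rewrite lerD2r ler_wpM2r ?sqr_ge0//.
  by rewrite ler_pM2r ?invr_gt0// ler_pM2l// /L lerDr.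
(* two points of [X] are equal when [Lf] is negative *)
have -> : D = 0.
  apply: enorm_eq0; apply/eqP; rewrite eq_le enorm_ge0 andbT.
  rewrite -(nmulr_rge0 _ Lf0).
  by apply: le_trans (hf_smooth.2 _ _ Xz' Xz); exact: enorm_ge0.
have -> : dotv nu 0 = 0 by rewrite -(subrr nu) dotvBr subrr.
rewrite mulr0 oppr0 addr_ge0//; (apply: mulr_ge0; last exact: sqr_ge0).
  by rewrite divr_ge0// mulr_ge0// ltW.
by rewrite divr_ge0// mulr_ge0// ltW.
Qed.

End Path.

(** * Measurability of the iterates *)

Section MeasurableVector.
Context (R : realType) d (H : measurableType d).

Definition measurable_vector n (v : H -> 'rV[R]_n) :=
  forall j, measurable_fun setT (fun w => v w 0 j).

Lemma measurable_vector_cst n (v : 'rV[R]_n) : measurable_vector (fun=> v).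
Proof. by move=> j. Qed.

Lemma measurable_vectorD n (u v : H -> 'rV[R]_n) : measurable_vector u ->
  measurable_vector v -> measurable_vector (fun w => u w + v w).
Proof.
by move=> mu mv j; under eq_fun do rewrite mxE; exact: measurable_funD.
Qed.

Lemma measurable_vectorZ n (a : R) (v : H -> 'rV[R]_n) :
  measurable_vector v -> measurable_vector (fun w => a *: v w).
Proof.
by move=> mv j; under eq_fun do rewrite mxE; exact: measurable_funM.
Qed.

Lemma measurable_vectorB n (u v : H -> 'rV[R]_n) : measurable_vector u ->
  measurable_vector v -> measurable_vector (fun w => u w - v w).
Proof.
move=> mu mv; under eq_fun do rewrite -scaleN1r.
by apply: measurable_vectorD => //; exact: measurable_vectorZ.
Qed.

Lemma measurable_pos_part_coord n m (c : 'rV[R]_n -> 'rV[R]_m)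
    (v : H -> 'rV[R]_n) i : C1 (fun x => c x 0 i) -> measurable_vector v ->
  measurable_fun setT (fun w => pos_part (c (v w)) 0 i).
Proof.
move=> ci mv; under eq_fun do rewrite mxE.
apply: measurable_maxr => //.
apply: (measurable_continuous_comp (phi := fun x => c x 0 i) mv) => x.
exact/differentiable_continuous/ci.1.
Qed.

Lemma measurable_penalty_grad n m (c : 'rV[R]_n -> 'rV[R]_m)
    (v : H -> 'rV[R]_n) : (forall i, C1 (fun x => c x 0 i)) ->
  measurable_vector v -> measurable_vector (fun w => penalty_grad c (v w)).
Proof.
move=> cC1 mv j; under eq_fun do rewrite /penalty_grad summxE.
apply: measurable_sum => i; under eq_fun do rewrite mxE.
apply: measurable_funM; first exact: measurable_pos_part_coord.
exact: (@measurable_grad_comp R n _ H (fun u _ => c u 0 i) (fun _ => cC1 i)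
  (fun u => measurable_cst _) _ H v id j mv).
Qed.

(** The minimisers [z w] are only given as a selection, but their increments are
    bounded by those of [v], which is enough for measurability. *)
Lemma measurable_vector_prox n (psi : 'rV[R]_n -> \bar R) (gamma : R)
    (v z : H -> 'rV[R]_n) : proper_closed_convex psi -> 0 < gamma ->
  (forall w, prox gamma psi (v w) (z w)) ->
  measurable_vector v -> measurable_vector z.
Proof.
move=> hpsi g0 vz mv j; apply: (measurable_lipschitz_comp (L := 1) mv) => w w'.
rewrite mul1r; apply: le_trans (prox_nonexpansive hpsi g0 (vz w) (vz w')).
by apply: le_trans (coord_le_enorm _ j); rewrite !mxE.
Qed.

Lemma bounded_measurable_dotv n (u v : H -> 'rV[R]_n) :
  (forall j, bounded_measurable (fun w => u w 0 j)) ->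
  (forall j, bounded_measurable (fun w => v w 0 j)) ->
  bounded_measurable (fun w => dotv (u w) (v w)).
Proof.
move=> bu bv; apply: bounded_measurable_sum => j _.
exact: bounded_measurableM.
Qed.

End MeasurableVector.

Section Process.
Context (R : realType) (n m : nat) (d d' : measure_display)
  (T : measurableType d) (P : probability T R) (Xi : measurableType d')
  (xi : {RV P >-> Xi}) (ftilde : 'rV[R]_n -> Xi -> R)
  (psi : 'rV[R]_n -> \bar R) (c : 'rV[R]_n -> 'rV[R]_m).
Let f := expected_fun ftilde xi.
Let X := dom psi.
Hypothesis hf_C1 : forall s, C1 (fun x => ftilde x s).
Hypothesis hf_meas : forall x, measurable_fun setT (ftilde x).
Hypothesis hpsi : proper_closed_convex psi.
Hypothesis hc_C1 : forall i, C1 (fun x => c x 0 i).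
Context (DX Lf sigma G : R).
Hypothesis hDX : forall x y, X x -> X y -> enorm (x - y) <= DX.
Hypothesis hf_smooth : smooth_on Lf X f.
Hypothesis hf_unbiased : forall x, X x -> forall j,
  ('E_P[fun w => (grad (fun u => ftilde u (xi w)) x 0 j)%R] =
     (grad f x 0 j)%:E)%E.
Hypothesis hf_var : forall x, X x ->
  ('E_P[fun w => (enorm (grad (fun u => ftilde u (xi w)) x - grad f x)
                    ^+ 2)%R] <= (sigma ^+ 2)%:E)%E.
Hypothesis hf_bound : forall x, X x -> forall s,
  enorm (grad (fun u => ftilde u s) x) <= G.
Context (x1 : 'rV[R]_n) (beta gamma rho : nat -> R) (xis : nat -> {RV P >-> Xi})
  (x y z g : nat -> T -> 'rV[R]_n).
Hypothesis hx1 : X x1.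
Hypothesis hbeta1 : forall k, (1 <= k)%N -> 1 <= beta k.
Hypothesis hgamma0 : forall k, (1 <= k)%N -> 0 < gamma k.
Hypothesis hrun : forall w, algorithm_run ftilde psi c x1 beta gamma rho
     (fun k => xis k w) (fun k => x k w) (fun k => y k w)
     (fun k => z k w) (fun k => g k w).

Let H k := pastT xis k.

Lemma measurable_run_y k :
  measurable_vector (x k.+1 : H k -> _) ->
  measurable_vector (z k.+1 : H k -> _) ->
  measurable_vector (y k.+1 : H k -> _).
Proof.
move=> mx mz.
have -> : y k.+1 = fun w =>
    (1 - (beta k.+1)^-1) *: x k.+1 w + (beta k.+1)^-1 *: z k.+1 w.
  by apply/funext => w; rewrite (run_y (hrun w)).
apply: (@measurable_vectorD _ _ (H k)); exact: (@measurable_vectorZ _ _ (H k)).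
Qed.

(** Index shift: the sample of index [k.+1] enters through [g k.+1], hence
    [x k.+1] and [z k.+1] depend on the samples of index 1 to [k], and [y k.+1]
    as well. *)
Lemma measurable_run k :
  measurable_vector (x k.+1 : H k -> _) /\ measurable_vector (z k.+1 : H k -> _).
Proof.
elim: k => [|k [mx mz]].
  have -> : x 1%N = fun=> x1 by apply/funext => w; rewrite (run_x1 (hrun w)).
  have -> : z 1%N = fun=> x1 by apply/funext => w; rewrite (run_z1 (hrun w)).
  by split; exact: (@measurable_vector_cst _ _ (H 0%N)).
have my : measurable_vector (y k.+1 : H k.+1 -> _).
  by move=> j; apply: measurable_pastS; exact: measurable_run_y.
have {}mx : measurable_vector (x k.+1 : H k.+1 -> _).
  by move=> j; apply: measurable_pastS; exact: mx.
have {}mz : measurable_vector (z k.+1 : H k.+1 -> _).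
  by move=> j; apply: measurable_pastS; exact: mz.
have mz' : measurable_vector (z k.+2 : H k.+1 -> _).
  apply: (@measurable_vector_prox _ _ (H k.+1) n psi (gamma k.+1)
    (fun w => z k.+1 w - gamma k.+1 *: (grad (fun u => ftilde u (xis k.+1 w))
      (y k.+1 w) + rho k.+1 *: penalty_grad c (y k.+1 w)))) => //.
  - exact: hgamma0.
  - by move=> w; have := run_z (hrun w) (ltn0Sn k); rewrite (run_g (hrun w)).
  - apply: (@measurable_vectorB _ _ (H k.+1)) => //.
    apply: (@measurable_vectorZ _ _ (H k.+1)).
    apply: (@measurable_vectorD _ _ (H k.+1)).
      move=> j; apply: (@measurable_grad_comp _ _ _ _ _ hf_C1 hf_meas _ (H k.+1)) => //.
      exact: measurable_sample.
    apply: (@measurable_vectorZ _ _ (H k.+1)).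
    exact: (@measurable_penalty_grad _ _ (H k.+1)).
split => //.
have -> : x k.+2 = fun w =>
    (1 - (beta k.+1)^-1) *: x k.+1 w + (beta k.+1)^-1 *: z k.+2 w.
  by apply/funext => w; rewrite (run_x (hrun w)).
apply: (@measurable_vectorD _ _ (H k.+1)); exact: (@measurable_vectorZ _ _ (H k.+1)).
Qed.

Lemma enorm_grad_f v : X v -> enorm (grad f v) <= G.
Proof.
by move=> Xv; exact: (enorm_grad_expected hf_C1 hf_meas (hf_unbiased Xv) (hf_bound Xv)).
Qed.

Let run_X w k (k1 : (1 <= k)%N) := run_dom hpsi hx1 hbeta1 hgamma0 (hrun w) k1.
Let run_yX w k (k1 : (1 <= k)%N) := run_y_dom hpsi hx1 hbeta1 hgamma0 (hrun w) k1.

(** The sample is a separate argument, so that the expectation can be taken over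
    it while the past, carried by [w], is frozen. *)
Definition noise_term (u : 'rV[R]_n) (a b : R) k (w : T) (s : Xi) : R :=
  let dl := grad (fun u => ftilde u s) (y k w) - grad f (y k w) in
  a * dotv dl (u - z k w) + b * enorm dl ^+ 2.

Lemma bounded_measurable_noise_term u a b k : X u ->
  bounded_measurable (fun p : H k * Xi => noise_term u a b k.+1 p.1 p.2).
Proof.
move=> Xu; have [mx mz] := measurable_run k; have my := measurable_run_y mx mz.
have bdl j : bounded_measurable (fun p : H k * Xi =>
   (grad (fun u => ftilde u p.2) (y k.+1 p.1) - grad f (y k.+1 p.1)) 0 j).
  split.
    under eq_fun do rewrite row_subE; apply: measurable_funB.
      have my1 : measurable_vector (fun p : H k * Xi => y k.+1 p.1).
        by move=> i; exact: (measurableT_comp (my i) (@measurable_fst _ _ (H k) Xi)).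
      exact: (@measurable_grad_comp _ _ _ _ _ hf_C1 hf_meas _ (H k * Xi)%type
        (fun p => y k.+1 p.1) snd j my1 (@measurable_snd _ _ (H k) Xi)).
    have mg : measurable_fun setT (fun w : H k => grad f (y k.+1 w) 0 j).
      apply: (measurable_lipschitz_comp (L := Lf) my) => w w'.
      have := hf_smooth.2 _ _ (run_yX w (ltn0Sn k)) (run_yX w' (ltn0Sn k)).
      by apply: le_trans; apply: le_trans (coord_le_enorm _ j); rewrite !mxE.
    exact: (measurableT_comp mg (@measurable_fst _ _ (H k) Xi)).
  exists (G + G) => p; apply: le_trans (coord_le_enorm _ j) _.
  apply: le_trans (enormB _ _) _.
  have Xy := run_yX p.1 (ltn0Sn k).
  by apply: lerD; [exact: hf_bound|exact: enorm_grad_f].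
have bz j : bounded_measurable (fun p : H k * Xi => (u - z k.+1 p.1) 0 j).
  split.
    under eq_fun do rewrite row_subE; apply: measurable_funB => //.
    exact: (measurableT_comp (mz j) (@measurable_fst _ _ (H k) Xi)).
  exists DX => p; apply: le_trans (coord_le_enorm _ j) _.
  by have [_ Xz] := run_X p.1 (ltn0Sn k); rewrite hDX.
rewrite /noise_term; apply: bounded_measurableD; apply: bounded_measurableZ.
  exact: bounded_measurable_dotv.
by under eq_fun do rewrite enormE; exact: bounded_measurable_dotv.
Qed.

Hypothesis hxis_law : forall k, (1 <= k)%N -> same_law (xis k) xi.
Hypothesis hxis_indep : mutually_independent [set k | (1 <= k)%N] xis.

(** For a frozen past the linear part has mean zero, since the sampled gradients
    are unbiased, and the quadratic part is bounded by the variance. *)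
Lemma Rintegral_noise_term u a b k : X u -> 0 <= b ->
  \int[P]_w noise_term u a b k.+1 w (xis k.+1 w) <= b * sigma ^+ 2.
Proof.
move=> Xu b0.
apply: (sample_Rintegral_le hxis_indep (hxis_law (ltn0Sn k))).
  exact: bounded_measurable_noise_term.
move=> w; have Xy := run_yX w (ltn0Sn k); set v := u - z k.+1 w.
set q := y k.+1 w in Xy *.
have bg j : bounded_measurable (fun w' =>
    (grad (fun u => ftilde u (xi w')) q - grad f q) 0 j).
  under eq_fun do rewrite row_subE; apply: bounded_measurableD.
    exact: (bounded_measurable_grad_sample _ hf_C1 hf_meas (hf_bound Xy)).
  exact: bounded_measurable_cst.
have b1 : bounded_measurable (fun w' =>
    dotv (grad (fun u => ftilde u (xi w')) q - grad f q) v).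
  by apply: bounded_measurable_dotv => // j; exact: bounded_measurable_cst.
have b2 : bounded_measurable (fun w' =>
    enorm (grad (fun u => ftilde u (xi w')) q - grad f q) ^+ 2).
  by under eq_fun do rewrite enormE; exact: bounded_measurable_dotv.
rewrite /noise_term -/q -/v Rintegral_bmD ?Rintegral_bmZ//; last 2 first.
- exact: bounded_measurableZ.
- exact: bounded_measurableZ.
have -> : \int[P]_w' dotv (grad (fun u => ftilde u (xi w')) q - grad f q) v = 0.
  under eq_Rintegral do rewrite dotvBl.
  have bd := bounded_measurable_dotv_grad_sample xi hf_C1 hf_meas (hf_bound Xy) v.
  rewrite RintegralB//; last 2 first.
  - exact: bounded_measurable_integrable.
  - exact: (bounded_measurable_integrable _ (bounded_measurable_cst _ _)).
  rewrite (unbiased_dotv hf_C1 hf_meas (hf_unbiased Xy) (hf_bound Xy)).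
  by rewrite Rintegral_prob_cst subrr.
rewrite mulr0 add0r ler_wpM2l// -lee_fin -EFin_Rintegral_bm//.
by have := hf_var Xy; rewrite unlock.
Qed.

Lemma bounded_measurable_noise_sample u a b k : X u ->
  bounded_measurable (fun w => noise_term u a b k.+1 w (xis k.+1 w)).
Proof.
move=> Xu; have [mN [M NM]] := bounded_measurable_noise_term a b k Xu.
split; last by exists M => w; exact: (NM (w, _)).
apply: (measurableT_comp mN (g := fun w : T => (w : H k, xis k.+1 w))).
by apply: measurable_fun_pair; [exact: pastT_id|exact: measurable_funP].
Qed.

End Process.

(** * Rates *)

Section Rates.
Context (R : realType).

Lemma sqrt_mul_sqr (a q : R) : 0 <= q -> Num.sqrt (a * q ^+ 2) = Num.sqrt a * q.
Proof.
move=> q0; have [a0|/ltW a0] := leP 0 a.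
  by rewrite sqrtrM// sqrtr_sqr ger0_norm.
by rewrite !ler0_sqrtr ?mul0r// mulr_le0_ge0// sqr_ge0.
Qed.

Lemma powR_quarter (a : R) (j : nat) : 0 <= a ->
  a `^ (j%:R / 4) = (a `^ (1 / 4)) ^+ j.
Proof.
move=> a0; rewrite -powR_mulrn ?powR_ge0// -powRrM; congr powR.
by rewrite mul1r mulrC.
Qed.

Lemma sqrt_max0 (a b : R) : 0 <= a -> Num.sqrt (a * Num.max b 0) = Num.sqrt (a * b).
Proof.
move=> a0; case: (leP b 0) => // b0.
by rewrite mulr0 sqrtr0 ler0_sqrtr// mulr_ge0_le0.
Qed.

(** If [u] exceeded the right-hand side, then u^2 would exceed
    (2 Lam / rho) u + s^2, where s is the sum of the square roots, whose square
    dominates the sum of the radicands. *)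
Lemma quadratic_bound (rho Lam u B1 B2 B3 : R) : 0 < rho -> 0 <= Lam -> 0 <= u ->
  0 <= B1 -> 0 <= B2 -> 0 <= B3 ->
  rho / 2 * u ^+ 2 - Lam * u <= B1 + B2 + B3 ->
  u <= Num.sqrt (2 * B1 / rho) + Num.sqrt (2 * B2 / rho) + 2 * Lam / rho
       + Num.sqrt (2 * B3 / rho).
Proof.
move=> r0 L0 u0 b1 b2 b3 H.
have S B : 0 <= B -> Num.sqrt (2 * B / rho) ^+ 2 = 2 * B / rho.
  by move=> B0; rewrite sqr_sqrtr// divr_ge0// ?mulr_ge0// ltW.
move: (S _ b1) (S _ b2) (S _ b3).
set s1 := Num.sqrt _; set s2 := Num.sqrt _; set s3 := Num.sqrt _ => E1 E2 E3.
have s10 : 0 <= s1 by exact: sqrtr_ge0.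
have s20 : 0 <= s2 by exact: sqrtr_ge0.
have s30 : 0 <= s3 by exact: sqrtr_ge0.
have l0 : 0 <= 2 * Lam / rho by rewrite divr_ge0 ?mulr_ge0// ltW.
have {}H : u ^+ 2 <= 2 * Lam / rho * u + (s1 ^+ 2 + s2 ^+ 2 + s3 ^+ 2).
  rewrite E1 E2 E3 -(ler_pM2l r0).
  have -> : rho * (2 * Lam / rho * u + (2 * B1 / rho + 2 * B2 / rho + 2 * B3 / rho))
    = 2 * (Lam * u + (B1 + B2 + B3)) by field; rewrite gt_eqF.
  lra.
rewrite leNgt; apply/negP => lt.
set s := s1 + s2 + s3.
have ss : s1 ^+ 2 + s2 ^+ 2 + s3 ^+ 2 <= s * s.
  by have := mulr_ge0 s10 s20; have := mulr_ge0 s10 s30;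
     have := mulr_ge0 s20 s30; rewrite /s; lra.
have s0 : 0 <= s by rewrite !addr_ge0.
have lt' : 2 * Lam / rho + s < u by rewrite /s; lra.
have us : s * s <= s * u by apply: ler_wpM2l => //; lra.
have up : 0 < u by lra.
have := mulr_gt0 up (_ : 0 < u - (2 * Lam / rho + s)).
rewrite subr_gt0 => /(_ lt'); lra.
Qed.

Context (r Lf Lc2 DX Lam : R).
Hypotheses (r0 : 0 < r) (DX0 : 0 < DX) (Lam0 : 0 <= Lam).
Let L := Lf + r ^+ 6 * Lc2.
Hypothesis L0 : 0 < L.

(** Here [r ^ 4] stands for [K] and [r ^ 6] for the penalty parameter
    [K ^ (3 / 2)], so that all the powers of [K] in the rates are integral powers
    of [r]. *)
Lemma smooth_rate : 4 * L * DX ^+ 2 / (r ^+ 4) ^+ 2 <=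
  6 * Lc2 * DX ^+ 2 / r ^+ 2 + 6 * Lf * DX ^+ 2 / r ^+ 8.
Proof.
have -> : 6 * Lc2 * DX ^+ 2 / r ^+ 2 + 6 * Lf * DX ^+ 2 / r ^+ 8 =
    6 * (L * DX ^+ 2 / (r ^+ 4) ^+ 2).
  by rewrite /L; field; rewrite gt_eqF.
rewrite -!mulrA ler_wpM2r ?ler_nat// mulr_ge0 ?(ltW L0)//.
by rewrite mulr_ge0 ?divr_ge0 ?sqr_ge0 ?(ltW DX0).
Qed.

(** When [Lf] is negative its square root is 0 and the last term of the
    hypothesis is negative: both agree with the case of [Num.max Lf 0]. *)
Lemma violation_rate (u A B : R) : 0 <= u -> 0 <= A -> 0 <= B ->
  r ^+ 6 / 2 * u ^+ 2 - Lam * u <=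
    A + B / r ^+ 2 + 6 * Lf * DX ^+ 2 / r ^+ 8 ->
  u <= Num.sqrt (2 * A) * (r ^+ 3)^-1 + Num.sqrt (2 * B) * (r ^+ 4)^-1
    + 2 * Lam * (r ^+ 6)^-1 + Num.sqrt (12 * Lf) * DX * (r ^+ 7)^-1.
Proof.
move=> u0 A0 B0 H; set M := Num.max Lf 0.
have M0 : 0 <= M by rewrite le_max lexx orbT.
have rn0 : r != 0 by rewrite gt_eqF.
have {}H : r ^+ 6 / 2 * u ^+ 2 - Lam * u <=
    A + B / r ^+ 2 + 6 * M * DX ^+ 2 / r ^+ 8.
  apply: le_trans H _; rewrite lerD2l -!mulrA ler_pM2l// ler_wpM2r//.
    by rewrite mulr_ge0 ?divr_ge0 ?exprn_ge0 ?(ltW DX0) ?(ltW r0).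
  by rewrite le_max lexx.
have := quadratic_bound (exprn_gt0 6 r0) Lam0 u0 A0 _ _ H.
have B0' : 0 <= B / r ^+ 2 by rewrite divr_ge0// sqr_ge0.
have M0' : 0 <= 6 * M * DX ^+ 2 / r ^+ 8.
  by rewrite divr_ge0 ?exprn_ge0 ?(ltW r0)// mulr_ge0 ?sqr_ge0// mulr_ge0.
move=> /(_ B0' M0').
have -> : 2 * A / r ^+ 6 = 2 * A * ((r ^+ 3)^-1) ^+ 2 by field.
have -> : 2 * (B / r ^+ 2) / r ^+ 6 = 2 * B * ((r ^+ 4)^-1) ^+ 2 by field.
have -> : 2 * (6 * M * DX ^+ 2 / r ^+ 8) / r ^+ 6 =
    12 * M * (DX / r ^+ 7) ^+ 2 by field.
rewrite !sqrt_mul_sqr ?invr_ge0 ?exprn_ge0 ?(ltW r0)//; last first.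
  by rewrite divr_ge0 ?exprn_ge0 ?ltW.
by rewrite sqrt_max0// mulrA.
Qed.

End Rates.

(** * Convergence of the method *)

Theorem theorem1 (R : realType) (n m : nat)
  (d d' : measure_display) (T : measurableType d) (P : probability T R)
  (Xi : measurableType d')
  (* problem data *)
  (xi : {RV P >-> Xi})
  (ftilde : 'rV[R]_n -> Xi -> R)
  (psi : 'rV[R]_n -> \bar R)
  (c : 'rV[R]_n -> 'rV[R]_m)
  (f := expected_fun ftilde xi)
  (F := objective ftilde xi psi)
  (X := dom psi)
  (hf_C1 : forall s, C1 (fun x => ftilde x s))
  (hf_convex : forall s, convex_fun (fun x => ftilde x s))
  (hf_meas : forall x, measurable_fun setT (ftilde x))
  (hf_int : forall x, P.-integrable setT (fun w => (ftilde x (xi w))%:E))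
  (hpsi : proper_closed_convex psi)
  (hc_C1 : forall i, C1 (fun x => c x 0 i))
  (hc_convex : forall i, convex_fun (fun x => c x 0 i))
  (Fstar : R)
  (hFstar : is_min (F @` feasible c) Fstar%:E)
  (* Assumption A *)
  (DX DF : R) (hDX0 : 0 < DX) (hDF0 : 0 < DF)
  (hDX : forall x y, X x -> X y -> enorm (x - y) <= DX)
  (hDF : forall x y, X x -> X y -> (F x - F y <= DF%:E)%E)
  (Lc Lgc C : 'I_m -> R)
  (hc_lip : forall i, elipschitz_on (Lc i) X (fun x => c x 0 i))
  (hc_smooth : forall i, smooth_on (Lgc i) X (fun x => c x 0 i))
  (hc_bound : forall i x, X x -> `|c x 0 i| <= C i)
  (hLambda_ne : opt_multipliers F c Fstar !=set0)
  (Lambda : R)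
  (hLambda : is_min (@enorm R m @` opt_multipliers F c Fstar) Lambda)
  (Lc2 := smoothness_c2 Lc Lgc C) (hLc2 : 0 < Lc2)
  (* Assumption B *)
  (Lf sigma G : R) (hsigma : 0 < sigma) (hG : 0 < G)
  (hf_smooth : smooth_on Lf X f)
  (hf_unbiased : forall x, X x -> forall j,
     ('E_P[fun w => (grad (fun u => ftilde u (xi w)) x 0 j)%R] =
        (grad f x 0 j)%:E)%E)
  (hf_var : forall x, X x ->
     ('E_P[fun w => (enorm (grad (fun u => ftilde u (xi w)) x - grad f x)
                       ^+ 2)%R]
        <= (sigma ^+ 2)%:E)%E)
  (hf_bound : forall x, X x -> forall s,
     enorm (grad (fun u => ftilde u s) x) <= G)
  (* Algorithm 1 *)
  (x1 : 'rV[R]_n) (hx1 : X x1)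
  (beta gamma rho : nat -> R)
  (hbeta1 : forall k, (1 <= k)%N -> 1 <= beta k)
  (hgamma0 : forall k, (1 <= k)%N -> 0 < gamma k)
  (hrho0 : forall k, (1 <= k)%N -> 0 < rho k)
  (xis : nat -> {RV P >-> Xi})
  (hxis_law : forall k, (1 <= k)%N -> same_law (xis k) xi)
  (hxis_indep : mutually_independent [set k | (1 <= k)%N] xis)
  (x y z g : nat -> T -> 'rV[R]_n)
  (hrun : forall w, algorithm_run ftilde psi c x1 beta gamma rho
     (fun k => xis k w) (fun k => x k w) (fun k => y k w)
     (fun k => z k w) (fun k => g k w))
  (* choice of the parameters *)
  (K : nat) (hK : (2 <= K)%N)
  (hrho : forall k, (1 <= k < K)%N -> rho k = K%:R `^ (3 / 2))
  (hbeta : forall k, (1 <= k < K)%N -> beta k = k.+1%:R / 2)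
  (hgamma : forall k, (1 <= k < K)%N ->
     gamma k = k.+1%:R / (4 * (Lf + rho k * Lc2))) :
  [/\ forall w, enorm (pos_part (c (x K w))) <=
        Num.sqrt (6 * G * DX) * K%:R `^ (- (3 / 4))
        + Num.sqrt (12 * Lc2) * DX * K%:R^-1
        + 2 * Lambda * K%:R `^ (- (3 / 2))
        + Num.sqrt (12 * Lf) * DX * K%:R `^ (- (7 / 4)),
      (\int[P]_w (F (x K w) - Fstar%:E) <=
        ((6 * Lc2 * DX ^+ 2 + 3 * sigma ^+ 2 * Lc2^-1) * K%:R `^ (- (1 / 2))
         + 6 * Lf * DX ^+ 2 * K%:R ^- 2)%:E)%E &
      (\int[P]_w (F (x K w) - Fstar%:E) >=
        (- Lambda * (Num.sqrt (12 * Lc2 * DX ^+ 2 + 6 * sigma ^+ 2 * Lc2^-1)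
                       * K%:R^-1
                     + 2 * Lambda * K%:R `^ (- (3 / 2))
                     + Num.sqrt (12 * Lf) * DX * K%:R `^ (- (7 / 4))))%:E)%E].
Proof.
have cf : convex_fun f := expected_fun_convex hf_convex hf_int.
have dX v : X v -> psi v = (fine (psi v))%:E := dom_fine hpsi (x := v).
pose Fr v := f v + fine (psi v).
have FE v : X v -> F v = (Fr v)%:E.
  by move=> Xv; rewrite /F /objective -/f dX.
have [[u cu Fu] _] := hFstar.
have Xu : X u.
  move: Fu; rewrite /F /objective /X /dom /=.
  by case: (psi u) => [q _||]//; rewrite ltry.
have FruE : Fr u = Fstar by move: Fu; rewrite FE// => -[].
have penu : penalty c u = 0.
  rewrite penaltyE big1// => i _; rewrite max_r ?expr0n ?mul0r//; exact: cu.
have [[lam [lam0 [_ Flam]] lamE] _] := hLambda.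
have Lam0 : 0 <= Lambda by rewrite -lamE enorm_ge0.
have mult v : X v -> - (Lambda * enorm (pos_part (c v))) <= Fr v - Fstar.
  move=> Xv; have := Flam (F v + (dotv lam (c v))%:E)%E.
  have /[swap]/[apply] : range (fun x => (F x + (dotv lam (c x))%:E)%E)
    (F v + (dotv lam (c v))%:E)%E by exists v.
  rewrite FE// -EFinD lee_fin => H.
  have : dotv lam (c v) <= Lambda * enorm (pos_part (c v)).
    rewrite -lamE; apply: le_trans (cauchy_schwarz _ _); apply: ler_sum => i _.
    by rewrite ler_wpM2l// mxE le_max lexx.
  lra.
have K0 : (0 < K)%N by rewrite (ltn_trans _ hK).
pose r := K%:R `^ (1 / 4) : R.
have r0 : 0 < r by rewrite powR_gt0// ltr0n.
have rE j : K%:R `^ (j%:R / 4) = r ^+ j by rewrite powR_quarter.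
have rK : r ^+ 4 = K%:R by rewrite -rE divff ?powRr1.
have E32 : 3 / 2 = 6%:R / 4 :> R by field.
have E12 : 1 / 2 = 2%:R / 4 :> R by field.
have rho6 : K%:R `^ (3 / 2) = r ^+ 6 by rewrite E32 rE.
rewrite !powRN E12 -/(3%:R / 4) !rE rho6.
pose L := Lf + r ^+ 6 * Lc2.
have hrho' k : (1 <= k < K)%N -> rho k = r ^+ 6 by move=> kK; rewrite hrho.
have hgamma' k : (1 <= k < K)%N -> gamma k = k.+1%:R / (4 * L).
  by move=> kK; rewrite hgamma// hrho'.
have L0 : 0 < L.
  have := hgamma0 1%N isT; rewrite hgamma' ?hK//.
  by rewrite pmulr_rgt0// invr_gt0 pmulr_rgt0.
have rh0 : 0 < r ^+ 6 by rewrite exprn_gt0.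
have XK w : X (x K w).
  by have [] := run_dom hpsi hx1 hbeta1 hgamma0 (hrun w) K0.
pose v w := enorm (pos_part (c (x K w))).
have v0 w : 0 <= v w by exact: enorm_ge0.
have pE w : penalized psi c f (r ^+ 6) (x K w) - penalized psi c f (r ^+ 6) u =
    Fr (x K w) - Fstar + r ^+ 6 / 2 * v w ^+ 2.
  by rewrite /penalized penu -FruE /Fr /penalty -/(v w); lra.
have SR : 4 * L * DX ^+ 2 / K%:R ^+ 2 <=
    6 * Lc2 * DX ^+ 2 / r ^+ 2 + 6 * Lf * DX ^+ 2 / r ^+ 8.
  by rewrite -rK; exact: smooth_rate.
have part1 w : v w <=
    Num.sqrt (6 * G * DX) * (r ^+ 3)^-1 + Num.sqrt (12 * Lc2) * DX * (r ^+ 4)^-1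
    + 2 * Lambda * (r ^+ 6)^-1 + Num.sqrt (12 * Lf) * DX * (r ^+ 7)^-1.
  have := run_bound_surely hpsi cf hc_convex hf_smooth hc_lip hc_smooth hc_bound
    hDX hx1 hbeta1 hgamma0 (hrun w) rh0 L0 hrho' hbeta hgamma' hK (G := G) Xu
    (fun v t Xv => hf_bound v Xv t)
    (fun v Xv => enorm_grad_expected hf_C1 hf_meas (hf_unbiased v Xv) (hf_bound v Xv)).
  rewrite -/f pE -/Lc2 -/L => H.
  have -> : Num.sqrt (6 * G * DX) = Num.sqrt (2 * (3 * G * DX)).
    by congr Num.sqrt; ring.
  have -> : Num.sqrt (12 * Lc2) * DX = Num.sqrt (2 * (6 * Lc2 * DX ^+ 2)).
    by rewrite -sqrt_mul_sqr ?(ltW hDX0)//; congr Num.sqrt; ring.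
  apply: violation_rate => //.
  - by rewrite !mulr_ge0// ltW.
  - by rewrite !mulr_ge0 ?sqr_ge0// ltW.
  - have := mult _ (XK w); have GD := mulr_gt0 hG hDX0.
    by rewrite -/(v w); lra.
pose M := r ^+ 6 * Lc2; have M0 : 0 < M by rewrite mulr_gt0.
pose N (k : nat) w := noise_term xi ftilde y z u (2 * k%:R) (k%:R * k.+1%:R / (2 * M))
  k w (xis k w).
have bN k : (1 <= k < K)%N -> bounded_measurable (N k).
  case: k => // k _.
  exact: (bounded_measurable_noise_sample hf_C1 hf_meas hpsi hc_C1 hDX hf_smooth
    hf_unbiased hf_bound hx1 hbeta1 hgamma0 hrun _ _ _ Xu).
have EN k : (1 <= k < K)%N ->
    \int[P]_w N k w <= k%:R * k.+1%:R / (2 * M) * sigma ^+ 2.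
  case: k => // k _.
  apply: (Rintegral_noise_term hf_C1 hf_meas hpsi hc_C1 hDX hf_smooth
    hf_unbiased hf_var hf_bound hx1 hbeta1 hgamma0 hrun hxis_law hxis_indep) => //.
  by rewrite divr_ge0 ?mulr_ge0// ltW.
pose S w := \sum_(1 <= k < K) N k w.
have bS : bounded_measurable S.
  by apply: bounded_measurable_sum => k; rewrite mem_index_iota => /bN.
pose D : R := K%:R * (K%:R - 1).
have K2 : 2 <= K%:R :> R by rewrite ler_nat.
have D0 : 0 < D by rewrite /D mulr_gt0//; lra.
(* each of the K - 1 coefficients k (k + 1) is at most D = K (K - 1) *)
have ES : \int[P]_w S w / D <= 3 * sigma ^+ 2 * Lc2^-1 / r ^+ 2.
  rewrite ler_pdivrMr// Rintegral_bm_sum; last first.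
    by move=> k; rewrite mem_index_iota => /bN.
  apply: (@le_trans _ _ (\sum_(1 <= k < K) (D / (2 * M) * sigma ^+ 2))).
    apply: ler_sum_nat => k kK; apply: le_trans (EN k kK) _.
    have M2 : 0 <= (2 * M)^-1 by rewrite invr_ge0; lra.
    apply: ler_wpM2r (sqr_ge0 _) _ _ _; apply: (ler_wpM2r M2).
    have /andP[_ kK'] := kK; rewrite /D mulrC ler_pM ?ler_nat//.
    by rewrite lerBrDr natr1 ler_nat.
  rewrite big_const_nat iter_addr_0 -[leLHS]mulr_natl natrB// -rK /M.
  have s0 : 0 <= D * (sigma ^+ 2 * Lc2^-1 / r ^+ 6).
    by rewrite mulr_ge0 ?(ltW D0)// divr_ge0 ?(ltW rh0)// divr_ge0 ?sqr_ge0 ?(ltW hLc2).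
  have -> : 3 * sigma ^+ 2 * Lc2^-1 / r ^+ 2 * D =
      3 * r ^+ 4 * (D * (sigma ^+ 2 * Lc2^-1 / r ^+ 6)).
    by field; rewrite !gt_eqF.
  have -> : (r ^+ 4 - 1) * (D / (2 * (r ^+ 6 * Lc2)) * sigma ^+ 2) =
      (r ^+ 4 - 1) / 2 * (D * (sigma ^+ 2 * Lc2^-1 / r ^+ 6)).
    by field; rewrite !gt_eqF.
  by rewrite ler_wpM2r// rK; lra.
pose rhs w := 4 * L * DX ^+ 2 / K%:R ^+ 2 + D^-1 * S w.
have brhs : bounded_measurable rhs.
  apply: bounded_measurableD; first exact: bounded_measurable_cst.
  exact: bounded_measurableZ.
have gap w : Fr (x K w) - Fstar + r ^+ 6 / 2 * v w ^+ 2 <= rhs w.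
  have := run_bound_noise hpsi cf hc_convex hf_smooth hc_lip hc_smooth hc_bound
    hDX hx1 hbeta1 hgamma0 (hrun w) rh0 L0 hrho' hbeta hgamma' hK Xu hLc2.
  by rewrite pE /rhs [D^-1 * _]mulrC.
have Erhs : \int[P]_w rhs w <=
    (6 * Lc2 * DX ^+ 2 + 3 * sigma ^+ 2 * Lc2^-1) / r ^+ 2
    + 6 * Lf * DX ^+ 2 / r ^+ 8.
  rewrite /rhs Rintegral_bmD; last 2 first.
  - exact: bounded_measurable_cst.
  - exact: bounded_measurableZ.
  rewrite Rintegral_prob_cst (Rintegral_bmZ P D^-1 bS).
  by rewrite [D^-1 * _]mulrC; lra.
have FxE w : (F (x K w) - Fstar%:E)%E = (Fr (x K w) - Fstar)%:E by rewrite FE.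
split.
- by move=> w; rewrite -rK; exact: part1.
- apply: (@le_trans _ _ (\int[P]_w (rhs w)%:E)%E).
    apply: le_integral_nonmeasurable => w; rewrite FxE lee_fin.
    have := gap w; have := mulr_ge0 (ltW rh0) (sqr_ge0 (v w)); lra.
  rewrite EFin_Rintegral_bm// lee_fin; apply: le_trans Erhs _.
  by rewrite -rK -exprM.
- have bv : bounded_measurable v.
    split; last by exists (Num.sqrt (6 * G * DX) * (r ^+ 3)^-1
      + Num.sqrt (12 * Lc2) * DX * (r ^+ 4)^-1 + 2 * Lambda * (r ^+ 6)^-1
      + Num.sqrt (12 * Lf) * DX * (r ^+ 7)^-1) => w; rewrite ger0_norm.
    have mx : measurable_vector (x K).
      rewrite -(prednK K0) => j; apply: measurable_past.
      exact: ((measurable_run hf_C1 hf_meas hpsi hc_C1 hgamma0 hrun K.-1).1 j).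
    rewrite /v /enorm /dotv.
    apply: (measurableT_comp (continuous_measurable_fun (@sqrt_continuous R))).
    by apply: measurable_sum => i; apply: measurable_funM;
      exact: measurable_pos_part_coord.
  pose U := \int[P]_w v w.
  have U0 : 0 <= U by apply: Rintegral_ge0 => w _; exact: v0.
  apply: (@le_trans _ _ (\int[P]_w (- Lambda * v w)%:E)%E); last first.
    by apply: le_integral_nonmeasurable => w; rewrite FxE lee_fin mulNr; exact: mult.
  rewrite EFin_Rintegral_bm ?Rintegral_bmZ//; last exact: bounded_measurableZ.
  rewrite lee_fin !mulNr lerN2 ler_wpM2l// -rK.
  have B0 : 0 <= 6 * Lc2 * DX ^+ 2 + 3 * sigma ^+ 2 * Lc2^-1.
    by rewrite addr_ge0// !mulr_ge0 ?sqr_ge0 ?invr_ge0// ?(ltW hLc2)// ltW.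
  have := violation_rate (Lf := Lf) r0 hDX0 Lam0 U0 (lexx 0) B0.
  rewrite add0r mulr0 sqrtr0 mul0r add0r.
  have -> : 2 * (6 * Lc2 * DX ^+ 2 + 3 * sigma ^+ 2 * Lc2^-1) =
    12 * Lc2 * DX ^+ 2 + 6 * sigma ^+ 2 * Lc2^-1 by ring.
  apply; apply: le_trans Erhs.
  (* Jensen's inequality, from the tangent of the square at [U] *)
  have -> : r ^+ 6 / 2 * U ^+ 2 - Lambda * U =
      \int[P]_w ((r ^+ 6 * U - Lambda) * v w + - (r ^+ 6 / 2 * U ^+ 2)).
    rewrite Rintegral_bmD ?Rintegral_bmZ ?Rintegral_prob_cst//; last 2 first.
    - exact: bounded_measurableZ.
    - exact: bounded_measurable_cst.
    by rewrite -/U; lra.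
  apply: le_Rintegral_bm => //.
    apply: bounded_measurableD; first exact: bounded_measurableZ.
    exact: bounded_measurable_cst.
  move=> w; have := gap w; have := mult _ (XK w); rewrite -/(v w).
  have := mulr_ge0 (ltW rh0) (sqr_ge0 (v w - U)); lra.
Qed.
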